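(* Let $p>1$ be an integer, put $q=1/p$, and let $\ln_p(2)=\sum_{k=1}^\infty \frac{(-1)^k}{p^k-1}$. For $n\ge 1$ define $$b_n = d_n(p^2)\,P_n(-p^n|q),\qquad a_n = d_n(p^2)\,Q_n(-p^n|q) - b_n\sum_{k=1}^{n-1}\frac{1}{p^k+1},$$ where $d_n(p^2)$ is the product of the first $n$ cyclotomic polynomials evaluated at $p^2$, $P_n(\cdot|q)$ is the little $q$-Legendre polynomial and $Q_n(\cdot|q)$ its associated polynomial (all defined in the context). Then $a_n\in\mathbb{Z}$, $b_n\in\mathbb{N}=\{1,2,\ldots\}$, and $b_n\ln_p(2)-a_n<0$. Furthermore $$\lim_{n\to\infty}|b_n\ln_p(2)-a_n|^{1/n^2} = p^{-\frac{3(\pi^2-4)}{2\pi^2}}<1.$$ Consequently $\ln_p(2)$ is irrational, and its measure of irrationality satisfies $r(\ln_p(2))\le \frac{2\pi^2}{\pi^2-4}$ $(=3.36295\ldots)$.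
   Context: For $0<q<1$ let $(a;q)_0=1$ and $(a;q)_k=(1-a)(1-aq)\cdots(1-aq^{k-1})$. The little $q$-Legendre polynomials are $$P_n(x|q)=\sum_{k=0}^n \frac{(q^{-n};q)_k\,(q^{n+1};q)_k}{(q;q)_k\,(q;q)_k}\,q^k x^k .$$ The associated polynomial $Q_n(x|q)$ (of degree $n-1$ in $x$) is $$Q_n(x|q)=\sum_{j=0}^\infty \frac{P_n(x|q)-P_n(q^j|q)}{x-q^j}\,q^j .$$ For an integer $m>1$, $d_n(m)=\prod_{k=1}^n\Phi_k(m)$, where $\Phi_k$ is the $k$-th cyclotomic polynomial. The measure of irrationality of an irrational real number $x$ is $$r(x)=\inf\{r\in\mathbb{R}: |x-a/b|<1/b^r \text{ has at most finitely many integer solutions } (a,b) \text{ with } b\ge 1\}.$$ *)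

(* Defs.v *)
From HB Require Import structures.
From mathcomp Require Import all_boot all_order all_algebra all_field.
From mathcomp Require Import all_classical all_reals all_analysis.

Set Implicit Arguments.
Unset Strict Implicit.
Unset Printing Implicit Defensive.

Import Order.TTheory GRing.Theory Num.Theory.
Import numFieldNormedType.Exports.

Local Open Scope classical_set_scope.
Local Open Scope ring_scope.

Definition qpoch (R : realType) (a q : R) (k : nat) : R :=
  \prod_(i < k) (1 - a * q ^+ i).

Definition little_qLegendre (R : realType) (q : R) (n : nat) (x : R) : R :=
  \sum_(k < n.+1)
    qpoch (q ^- n) q k * qpoch (q ^+ n.+1) q k / (qpoch q q k * qpoch q q k)
    * q ^+ k * x ^+ k.

(* The associated polynomial of the second kind. The formula is meant for x
   outside the grid {q^j | j : nat}: at a grid point the j-th difference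
   quotient is set to 0 here by the convention y / 0 = 0, instead of to the
   derivative. *)
Definition little_qLegendre_assoc (R : realType) (q : R) (n : nat) (x : R) : R :=
  limn [series
    (little_qLegendre q n x - little_qLegendre q n (q ^+ j)) / (x - q ^+ j)
    * q ^+ j]_j.

Definition cyclotomic_prod (n : nat) (m : int) : int :=
  \prod_(1 <= k < n.+1) ('Phi_k).[m].

(* With this normalization the value is negative, equal to
   - \sum_(k >= 1) 1 / (p^k + 1). *)
Definition qlog2 (R : realType) (p : nat) : R :=
  limn [series (-1) ^+ k.+1 / (p%:R ^+ k.+1 - 1) : R]_k.

Definition approx_den (R : realType) (p n : nat) : R :=
  (cyclotomic_prod n (p%:Z ^+ 2))%:~R
  * little_qLegendre (p%:R^-1) n (- p%:R ^+ n).

Definition approx_num (R : realType) (p n : nat) : R :=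
  (cyclotomic_prod n (p%:Z ^+ 2))%:~R
  * little_qLegendre_assoc (p%:R^-1) n (- p%:R ^+ n)
  - approx_den R p n * \sum_(1 <= k < n) (p%:R ^+ k + 1)^-1.

(* Extended-real valued, so that the infimum of the empty set is +oo (as for
   Liouville numbers) and not the default value 0 of the infimum in R. *)
Definition irrationality_measure (R : realType) (x : R) : \bar R :=
  ereal_inf [set r%:E | r in
    [set r : R | finite_set
      [set ab : int * int |
        1 <= ab.2 /\
        `|x - ab.1%:~R / ab.2%:~R| < (ab.2%:~R `^ r)^-1]]].

(* Main.v *)
(** With x = - p^n and A_k = [n, k] [n+k, k] p^(k choose 2) (Gaussian binomials
    in base p), the k-th term of P_n(x | q) is the natural number A_k.  By
    q-partial fractions P_n is orthogonal to polynomials of degree < n for the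
    discrete measure with mass q^j at q^j, with squared norm
    h = q^n / (1 - q^(2n+1)).  Orthogonality turns the remainder
    P_n(x) * (b_n ln_p(2) - a_n) / d_n(p^2) into the sum of the
    P_n(q^j)^2 q^j / (x - q^j), which lies between - h / p^n and
    - h / (p^n + 1).  The denominators of a_n are p^s - 1 and p^i + 1, which
    divide p^(2s) - 1 and p^(2i) - 1, hence d_n(p^2).

    The size of d_n comes from m^k - 1 = \prod_(d | k) Phi_d(m): summing logs,
    \sum_(e <= N) log d_(N / e)(m) = N^2 / 2 * log m + O(N).  This is inverted
    by the contraction |E(N)| <= o(N^2) + \sum_(2 <= e <= N) |E(N / e)|, where
    E(N) is the deviation of log d_N(m) from N^2 log m / (2 zeta(2)) and
    zeta(2) - 1 <= 3 / 4, and zeta(2) = pi^2 / 6 gives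
    log d_n(p^2) ~ 6 n^2 log p / pi^2.  A standard argument on
    rational approximations with two-sided quadratic-exponential rates then
    bounds the measure of irrationality. *)
Require Import Defs.
From HB Require Import structures.
From mathcomp Require Import all_boot all_order all_algebra all_field.
From mathcomp Require Import all_classical all_reals all_analysis.
From mathcomp Require Import ring lra zify.

Set Implicit Arguments.
Unset Strict Implicit.
Unset Printing Implicit Defensive.

Import Order.TTheory GRing.Theory Num.Theory.
Import numFieldNormedType.Exports.

Local Open Scope classical_set_scope.
Local Open Scope ring_scope.

(** Two things meet at the point x = - p^n. The k-th coefficient of P_n carries the sign (-1)^k and
    the denominator p^(n k), and the k-th power of x removes both. And the sum of the q^j / (x -
    q^j) is there a tail of the series - \sum 1 / (p^k + 1), whose value is ln_p(2); the missing n -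
    1 terms are the correction in a_n. The obstacle is the integrality of a_n: the associated
    polynomial brings in the values P_n(p^(n - i)), where the denominators do not cancel term by
    term, and a second expansion of P_n shows that these values are integers. P_n(- p^n) grows like
    p^(3 n^2 / 2), by its top term, and the error is d_n / P_n up to a factor p^(O(n)). So log b_n
    and log |error| have the rates (6 / pi^2 + 3 / 2) log p and (6 / pi^2 - 3 / 2) log p per n^2,
    and the method works because pi^2 > 4. The lower bound on the error matters as well: it settles
    the case where a competing fraction equals a_n / b_n. *)

(** * Gaussian binomials *)

Fixpoint qbinom (R : pzSemiRingType) (x : R) (n k : nat) : R :=
  match n, k with
  | _, 0%N => 1
  | 0%N, _.+1 => 0
  | n'.+1, k'.+1 => qbinom x n' k' + x ^+ k * qbinom x n' k
  end.

Arguments qbinom : simpl never.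

(** The q-factorial without the division of each factor by x - 1; up to the sign (-1)^n it is the
    Pochhammer symbol (x; x)_n. *)
Definition qfac (R : pzRingType) (x : R) (n : nat) : R :=
  \prod_(i < n) (x ^+ i.+1 - 1).

Section QBinomial.
Variables (R : comNzRingType) (x : R).

Lemma qbinom0 n : qbinom x n 0 = 1.
Proof. by case: n. Qed.

Lemma qbinomS n k :
  qbinom x n.+1 k.+1 = qbinom x n k + x ^+ k.+1 * qbinom x n k.+1.
Proof. by []. Qed.

Lemma qbinom_small n k : (n < k)%N -> qbinom x n k = 0.
Proof.
elim: n k => [|n IHn] [|k] // nk.
by rewrite qbinomS !IHn ?mulr0 ?addr0 //; lia.
Qed.

Lemma qbinomn n : qbinom x n n = 1.
Proof. by elim: n => // n IHn; rewrite qbinomS IHn qbinom_small // mulr0 addr0. Qed.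

Lemma qfac0 : qfac x 0 = 1.
Proof. by rewrite /qfac big_ord0. Qed.

Lemma qfacS n : qfac x n.+1 = qfac x n * (x ^+ n.+1 - 1).
Proof. by rewrite /qfac big_ord_recr. Qed.

Lemma qfacD m n :
  qfac x (m + n) = qfac x m * \prod_(i < n) (x ^+ (m + i).+1 - 1).
Proof. by rewrite /qfac big_split_ord. Qed.

(** Induction on m + k, since the recursion reaches both (m + 1, k) and (m, k + 1). The two
    contributions combine because x^(m + k + 2) - 1 = (x^(k + 1) - 1) + x^(k + 1) (x^(m + 1) -
    1). *)
Lemma qbinom_fac m k :
  qbinom x (m + k) k * qfac x k * qfac x m = qfac x (m + k).
Proof.
move: {2}(m + k)%N (erefl (m + k)%N) => s.
elim: s m k => [|s IHs] m k E.
  have [-> ->] : m = 0%N /\ k = 0%N by lia.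
  by rewrite qfac0 !mulr1.
case: m E => [|m] E; first by rewrite add0n qbinomn qfac0 mul1r mulr1.
case: k E => [|k] E; first by rewrite addn0 qbinom0 qfac0 !mul1r.
have E1 : (m.+1 + k = s)%N by lia.
have E2 : (m + k.+1 = s)%N by lia.
have := IHs _ _ E1; have := IHs _ _ E2.
rewrite !addnS !addSn !qfacS (qbinomS (m + k).+1) => H2 H1.
have {}H1 := congr1 ( *%R^~ (x ^+ k.+1 - 1)) H1.
have {}H2 := congr1 ( *%R^~ (x ^+ k.+1 * (x ^+ m.+1 - 1))) H2.
transitivity (qfac x (m + k) * (x ^+ (m + k).+1 - 1) * (x ^+ k.+1 - 1) +
   qfac x (m + k) * (x ^+ (m + k).+1 - 1) * (x ^+ k.+1 * (x ^+ m.+1 - 1))).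
  by rewrite -H1 -H2; ring.
by rewrite !exprS exprD; ring.
Qed.

Lemma qbinomial_theorem y N :
  \prod_(i < N) (1 + y * x ^+ i) =
  \sum_(k < N.+1) x ^+ 'C(k, 2) * qbinom x N k * y ^+ k.
Proof.
elim: N y => [|N IHN] y.
  by rewrite big_ord0 big_ord_recl big_ord0 /= expr0 !mulr1 addr0.
rewrite big_ord_recl expr0 mulr1.
transitivity ((1 + y) * \prod_(i < N) (1 + (y * x) * x ^+ i)).
  by congr (_ * _); apply: eq_bigr => i _; rewrite /= /bump add1n exprS mulrA.
rewrite IHN mulrDl mul1r.
rewrite big_ord_recl [in RHS]big_ord_recl /= !qbinom0 !expr0 -addrA.
congr (_ + _).
rewrite [in RHS](eq_bigr (fun k : 'I_N.+1 => x ^+ 'C(k, 2) * qbinom x N k * (x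
  * y) ^+ k * y + x ^+ 'C(k.+1, 2) * qbinom x N k.+1 * (y * x) ^+ k.+1));
    last first.
  move=> k _; rewrite /= /bump add1n qbinomS binS bin1.
  by rewrite exprD !exprMn !exprS; ring.
rewrite big_split /= [in RHS]addrC big_ord_recr /= qbinom_small // mulr0 mul0r
  addr0.
congr (_ + _).
rewrite big_ord_recl /= qbinom0 !expr0 mulrDr mulr1 mulrC; congr (_ + _).
by rewrite mulr_sumr; apply: eq_bigr => i _; rewrite [y * x]mulrC; ring.
Qed.

End QBinomial.

(** The division-free recursion that defines [qbinom] makes integrality immediate; the quotient of
    q-factorials would hide it. *)
Lemma qbinom_nat (R : archiRealDomainType) (x : R) n k :
  x \is a Num.nat -> qbinom x n k \is a Num.nat.
Proof.
move=> xN; elim: n k => [|n IHn] [|k]; rewrite ?qbinom0 // ?qbinomS.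
  by rewrite qbinom_small.
by rewrite rpredD ?rpredM ?rpredX.
Qed.

Lemma prod_neq_ord (R : comPzRingType) (f : nat -> R) n (k : 'I_n.+1) :
  \prod_(l < n.+1 | l != k) f l =
  (\prod_(l < k) f l) * \prod_(l < n - k) f (k.+1 + l)%N.
Proof.
have kn : (k <= n)%N by rewrite -ltnS.
transitivity (\prod_(0 <= l < n.+1 | l != k) f l); first by rewrite big_mkord.
rewrite (@big_cat_nat _ _ _ k) //=; last exact: leqW.
rewrite big_mkcond /= [X in _ * X]big_mkcond /= [X in _ * X]big_ltn // eqxx mul1r.
congr (_ * _).
  by rewrite big_mkord; apply: eq_bigr => i _; rewrite neq_ltn ltn_ord.
rewrite -{1}[k.+1]add0n big_addn subSS big_mkord; apply: eq_bigr => i _.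
by rewrite addnC ifT // neq_ltn; apply/orP; right; lia.
Qed.

(** Balances the powers of p in the partial-fraction residues. For m = 0 it reads C(k, 2) + C(k + 1,
    2) = k^2, which is used on its own below. *)
Lemma triangular_split k m :
  ('C(k, 2) + 'C((k + m).+1, 2) = (k + m) * k + 'C(m.+1, 2))%N.
Proof.
elim: m => [|m IHm].
  rewrite addn0; elim: k => // k IHk.
  by rewrite binS bin1 (binS k.+1) bin1; move: IHk; lia.
by rewrite addnS binS bin1 [in RHS]binS bin1; move: IHm; lia.
Qed.

Lemma size_prod_le2 (R : idomainType) (I : finType) (P : pred I) (F : I ->
  {poly R}) :
  (forall i, P i -> (size (F i) <= 2)%N) -> (size (\prod_(i | P i) F i)%R <=
    #|P|.+1)%N.
Proof.
move=> H; apply: leq_trans (size_poly_prod_leq _ _) _.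
rewrite leq_subLR addnS ltnS addnn -muln2.
by rewrite -sum_nat_const; apply: leq_sum => i /H.
Qed.

(** * Little q-Legendre polynomials in base p = 1 / q *)

Section PositiveBase.
Variables (R : realFieldType) (p : R).
Hypothesis p_gt1 : 1 < p.

Let p_gt0 : 0 < p. Proof. exact: lt_trans p_gt1. Qed.
Let p_neq0 : p != 0. Proof. exact: lt0r_neq0. Qed.

Lemma expr_sub1_gt0 i : 0 < p ^+ i.+1 - 1.
Proof. by rewrite subr_gt0 exprn_egt1. Qed.

Lemma qfac_gt0 n : 0 < qfac p n.
Proof. by apply: prodr_gt0 => i _; exact: expr_sub1_gt0. Qed.

Lemma qbinom_ge0 n k : 0 <= qbinom p n k.
Proof.
elim: n k => [|n IHn] [|k]; rewrite ?qbinom0 ?ler01 // ?qbinomS.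
by rewrite addr_ge0 // mulr_ge0 // exprn_ge0 // ltW.
Qed.

Lemma qbinomE n k : (k <= n)%N ->
  qbinom p n k = qfac p n / (qfac p k * qfac p (n - k)).
Proof.
move=> kn; rewrite -{2}(subnK kn) -(qbinom_fac p (n - k) k) subnK // -mulrA
  mulfK //.
by rewrite mulf_neq0 // gt_eqF // qfac_gt0.
Qed.

Lemma qbinom_sym m k : qbinom p (m + k) k = qbinom p (m + k) m.
Proof. by rewrite !qbinomE ?leq_addl ?leq_addr // addnK addKn [qfac p k *
  _]mulrC. Qed.

Lemma qpoch_invXn n k : (k <= n)%N ->
  \prod_(i < k) (1 - p^-1 ^- n * p^-1 ^+ i) =
  (-1) ^+ k * (qfac p n / qfac p (n - k)).
Proof.
have F0 i : qfac p i != 0 by rewrite gt_eqF // qfac_gt0.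
elim: k => [|k IHk] kn; first by rewrite big_ord0 subn0 divff // mulr1.
rewrite big_ord_recr /= IHk ?(ltnW kn) // !exprVn invrK -expfB //.
have := F0 (n - k)%N; rewrite -(subnSK kn) qfacS mulf_eq0 negb_or => /andP[a b].
move: (p ^+ _.+1) b => z b.
by rewrite exprS; field; rewrite b a.
Qed.

Lemma qpoch_inv m k :
  \prod_(i < k) (1 - p^-1 ^+ m.+1 * p^-1 ^+ i) =
  qfac p (m + k) / (qfac p m * p ^+ (m * k + 'C(k.+1, 2))).
Proof.
have F0 i : qfac p i != 0 by rewrite gt_eqF // qfac_gt0.
elim: k => [|k IHk].
  by rewrite big_ord0 addn0 muln0 bin_small // expr0 mulr1 divff // gt_eqF //
    qfac_gt0.
rewrite big_ord_recr /= {}IHk addnS qfacS.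
have -> : (m * k.+1 + 'C(k.+2, 2) = m * k + 'C(k.+1, 2) + (m + k).+1)%N.
  by rewrite (binS k.+1) bin1; lia.
rewrite -exprD !exprVn addSn [p ^+ (_ + _.+1)]exprD.
move: (p ^+ _.+1) (expf_neq0 (m + k).+1 p_neq0) => z z0.
move: (p ^+ _) (expf_neq0 (m * k + 'C(k.+1, 2)) p_neq0) => y y0.
by field; rewrite F0 z0 y0.
Qed.

(** The coefficient of x^k in P_n(x | 1 / p), with the Pochhammer symbols rewritten in base p >
    1. *)
Definition qleg_coef n k : R :=
  (-1) ^+ k * qbinom p n k * qbinom p (n + k) k * p ^+ 'C(k, 2) / p ^+ (n * k).

Lemma qleg_coefE n k : (k <= n)%N ->
  (\prod_(i < k) (1 - p^-1 ^- n * p^-1 ^+ i)) *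
  (\prod_(i < k) (1 - p^-1 ^+ n.+1 * p^-1 ^+ i)) /
  ((\prod_(i < k) (1 - p^-1 * p^-1 ^+ i)) * (\prod_(i < k) (1 - p^-1 * p^-1 ^+ i)))
  * p^-1 ^+ k = qleg_coef n k.
Proof.
have F0 i : qfac p i != 0 by rewrite gt_eqF // qfac_gt0.
move=> kn; have q0 : \prod_(i < k) (1 - p^-1 * p^-1 ^+ i) = _ := qpoch_inv 0 k.
rewrite qpoch_invXn // qpoch_inv q0.
rewrite /qleg_coef !qbinomE ?leq_addl // qfac0 addnK mul0n !add0n binS bin1.
rewrite exprVn !exprD.
have a := F0 k; have b := F0 n; have c := F0 (n - k)%N.
have d := expf_neq0 (n * k)%N p_neq0; have e := expf_neq0 'C(k, 2) p_neq0.
have f := expf_neq0 k p_neq0.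
by field; rewrite a b c d e f.
Qed.

Lemma qleg_coef_expN n k :
  qleg_coef n k * (- p ^+ n) ^+ k =
  qbinom p n k * qbinom p (n + k) k * p ^+ 'C(k, 2).
Proof.
rewrite /qleg_coef [(- p ^+ n) ^+ k]exprNn exprM;
  have := expf_neq0 k (expf_neq0 n p_neq0).
move: (_ ^+ k) => z z0.
have := sqrr_sign R k; rewrite expr2; move: (_ ^+ k) => s ss.
transitivity (s * s * (qbinom p n k * qbinom p (n + k) k * p ^+ 'C(k, 2))).
  by field.
by rewrite ss mul1r.
Qed.

Lemma prod_1sub_qfac t n :
  \prod_(i < n) (1 - p ^+ t.+1 * p ^+ i) =
  (-1) ^+ n * qfac p n * qbinom p (n + t) n.
Proof.
rewrite (eq_bigr (fun i : 'I_n => - (p ^+ (t + i).+1 - 1))); last first.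
  by move=> i _; rewrite -exprD addSn opprB.
rewrite prodrN cardT size_enum_ord -mulrA; congr (_ * _).
have F0 i : qfac p i != 0 by rewrite gt_eqF // qfac_gt0.
apply: (mulfI (F0 t)); rewrite -qfacD -(qbinom_fac p t n) addnC; ring.
Qed.

(** Negative powers of p occur here: for s < n the factor of index n - s - 1 is zero, in agreement
    with the vanishing binomial. *)
Lemma prod_1sub_shift s n :
  \prod_(i < n) (1 - p ^+ s.+1 / p ^+ n * p ^+ i) =
  (-1) ^+ n * qfac p n * qbinom p s n.
Proof.
have [sn|ns] := ltnP s n.
  rewrite qbinom_small // mulr0.
  have ltn : (n - s.+1 < n)%N by lia.
  rewrite (bigD1 (Ordinal ltn)) //= mulrAC -exprD subnKC //.
  by rewrite divff ?expf_neq0 // subrr mul0r.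
rewrite -(subnKC ns) -prod_1sub_qfac; apply: eq_bigr => i _.
by rewrite -addnS exprD [p ^+ n * _]mulrC mulfK ?expf_neq0.
Qed.

Definition qleg_poly n : {poly R} := \poly_(k < n.+1) qleg_coef n k.

Lemma horner_qleg n x :
  (qleg_poly n).[x] = \sum_(k < n.+1) qleg_coef n k * x ^+ k.
Proof. exact: horner_poly. Qed.

(** For integral p the terms of this expansion are integers, unlike those of the sum over the
    coefficients, which have the denominators p^(n k). Up to a constant the binomial [n + k, k] is
    (p^(k + 1); p)_n, which the q-binomial theorem expands; after exchanging the sums, the sum over
    k is a q-binomial product again. *)
Lemma horner_qleg_expr n j :
  (qleg_poly n).[p ^+ j.+1] =
  \sum_(l < n.+1)
    (-1) ^+ l * p ^+ ('C(l, 2) + l) * qbinom p n l * qbinom p (l + j) n.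
Proof.
have F0 i : qfac p i != 0 by rewrite gt_eqF // qfac_gt0.
rewrite horner_qleg.
have E k : qbinom p (n + k) k = (-1) ^+ n / qfac p n *
   \sum_(l < n.+1) p ^+ 'C(l, 2) * qbinom p n l * (- p ^+ k.+1) ^+ l.
  rewrite -qbinomial_theorem (eq_bigr (fun i : 'I_n => 1 - p ^+ k.+1 * p ^+ i)).
    rewrite prod_1sub_qfac qbinom_sym.
    have := sqrr_sign R n; rewrite expr2; move: (_ ^+ n) => s ss.
    transitivity (s * s * qbinom p (n + k) n); first by rewrite ss mul1r.
    by field; exact: F0.
  by move=> i _; rewrite mulNr.
transitivity (\sum_(k < n.+1) \sum_(l < n.+1)
   (p ^+ 'C(k, 2) * qbinom p n k * (- (p ^+ (l + j).+1 / p ^+ n)) ^+ k)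
   * ((-1) ^+ n / qfac p n * (-1) ^+ l * p ^+ ('C(l, 2) + l) * qbinom p n l)).
  apply: eq_bigr => k _; rewrite /qleg_coef E.
  rewrite !mulr_sumr !mulr_suml; apply: eq_bigr => l _.
  have d := expf_neq0 (n * k)%N p_neq0.
  rewrite exprD.
  have -> : (- p ^+ k.+1) ^+ l = (-1) ^+ l * p ^+ l * p ^+ (l * k).
    by rewrite [LHS]exprNn -exprM mulSn exprD mulrA (mulnC k).
  have -> : (- (p ^+ (l + j).+1 / p ^+ n)) ^+ k =
     (-1) ^+ k * p ^+ (l * k) * (p ^+ j.+1) ^+ k / p ^+ (n * k).
    by rewrite [LHS]exprNn -addnS exprD !exprMn exprVn -!exprM !mulrA.
  by field; rewrite F0 d.
rewrite exchange_big /=; apply: eq_bigr => l _.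
rewrite -mulr_suml -qbinomial_theorem.
under eq_bigr do rewrite mulNr.
rewrite prod_1sub_shift.
have := sqrr_sign R n; rewrite expr2; move: (_ ^+ n) => s ss.
transitivity (s * s * ((-1) ^+ l * p ^+ ('C(l, 2) + l) * qbinom p n l * qbinom
  p (l + j) n)).
  by field; exact: F0.
by rewrite ss mul1r.
Qed.

(** Up to normalization the coefficient is the residue at y = p^k of the rational function in
    [qleg_partial_fraction]. *)
Lemma qleg_coef_residue n (k : 'I_n.+1) :
  qleg_coef n k * \prod_(l < n.+1 | l != k) (1 - p ^+ k * p^-1 ^+ l) =
  \prod_(i < n) (p ^+ k - p^-1 ^+ i.+1).
Proof.
have F0 i : qfac p i != 0 by rewrite gt_eqF // qfac_gt0.
have kn : (k <= n)%N by rewrite -ltnS.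
rewrite (prod_neq_ord (fun l => 1 - p ^+ k * p^-1 ^+ l)).
have -> : \prod_(l < k) (1 - p ^+ k * p^-1 ^+ l) = (-1) ^+ k * qfac p k.
  have := qpoch_invXn (leqnn k); rewrite subnn qfac0 divr1 => <-.
  by apply: eq_bigr => l _; rewrite [p^-1 ^+ k]exprVn invrK.
have -> : \prod_(l < n - k) (1 - p ^+ k * p^-1 ^+ (k.+1 + l)) =
   qfac p (n - k) / p ^+ 'C((n - k).+1, 2).
  have := qpoch_inv 0 (n - k); rewrite qfac0 mul0n !add0n mul1r => <-.
  apply: eq_bigr => l _; rewrite addSnnS exprD mulrA exprVn divff ?expf_neq0 //.
  by rewrite mul1r exprS expr1.
have -> : \prod_(i < n) (p ^+ k - p^-1 ^+ i.+1) =
   p ^+ (k * n) * \prod_(i < n) (1 - p^-1 ^+ k.+1 * p^-1 ^+ i).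
  rewrite exprM -[X in p ^+ k ^+ X]card_ord -prodr_const -big_split /=.
  apply: eq_bigr => i _; rewrite mulrBr mulr1 -exprD addSnnS exprD mulrA.
  by rewrite [p^-1 ^+ k]exprVn divff ?expf_neq0 // mul1r.
rewrite qpoch_inv /qleg_coef !qbinomE ?leq_addl // addnK.
have := triangular_split k (n - k); rewrite subnKC // => E.
have {}E : p ^+ 'C(k, 2) * p ^+ 'C(n.+1, 2) = p ^+ (k * n) * p ^+ 'C((n - k).+1, 2).
  by rewrite -!exprD E mulnC.
have := sqrr_sign R k; rewrite expr2; move: ((-1) ^+ k) => s ss.
have a := expf_neq0 (k * n)%N p_neq0.
have b := expf_neq0 'C((n - k).+1, 2) p_neq0.
have c := expf_neq0 'C(n.+1, 2) p_neq0.
rewrite (mulnC n k) exprD (addnC n k).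
transitivity (s * s * (p ^+ 'C(k, 2) * p ^+ 'C(n.+1, 2)) * qfac p (k + n) /
  (qfac p k *  p ^+ (k * n) * p ^+ 'C((n - k).+1, 2) * p ^+ 'C(n.+1, 2))).
  by field; rewrite !F0 a b c.
rewrite ss E; field; by rewrite F0 a b c.
Qed.

Lemma qleg_partial_fraction n y :
  (forall k : 'I_n.+1, 1 - y * p^-1 ^+ k != 0) ->
  \sum_(k < n.+1) qleg_coef n k / (1 - y * p^-1 ^+ k) =
  (\prod_(i < n) (y - p^-1 ^+ i.+1)) / \prod_(k < n.+1) (1 - y * p^-1 ^+ k).
Proof.
move=> y0.
pose lin l : {poly R} := 1 - p^-1 ^+ l *: 'X.
have linE l x : (lin l).[x] = 1 - x * p^-1 ^+ l.
  by rewrite /lin !hornerE mulrC.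
(* The difference of both sides after clearing denominators. It has degree at most n and vanishes at
   the n + 1 points p^k, where only the k-th summand survives. *)
pose D : {poly R} := \sum_(k < n.+1) qleg_coef n k *: (\prod_(l < n.+1 | l !=
  k) lin l)
  - \prod_(i < n) ('X - (p^-1 ^+ i.+1)%:P).
have DE x : D.[x] = \sum_(k < n.+1) qleg_coef n k * (\prod_(l < n.+1 | l != k)
  (1 - x * p^-1 ^+ l)) - \prod_(i < n) (x - p^-1 ^+ i.+1).
  rewrite hornerD hornerN horner_sum horner_prod; congr (_ - _).
    by apply: eq_bigr => k _; rewrite hornerZ horner_prod;
      under eq_bigr do rewrite linE.
  by apply: eq_bigr => i _; rewrite hornerXsubC.
have sD : (size D <= n.+1)%N.
  apply: leq_trans (size_polyD _ _) _; rewrite geq_max; apply/andP; split.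
    apply: (leq_trans (size_sum _ _ _)); apply/bigmax_leqP => k _.
    apply: leq_trans (size_scale_leq _ _) _.
    apply: leq_trans (size_prod_le2 _) _.
      move=> i _; apply: leq_trans (size_polyD _ _) _;
        rewrite geq_max size_poly1 /= size_polyN.
      by apply: leq_trans (size_scale_leq _ _) _; rewrite size_polyX.
    by rewrite cardC1 card_ord.
  by rewrite size_polyN size_prod_XsubC /index_enum -enumT size_enum_ord.
have D0 : D = 0.
  apply: (@roots_geq_poly_eq0 _ D [seq p ^+ (k : 'I_n.+1) | k <- enum 'I_n.+1]).
  - apply/allP => x /mapP[k _ ->]; apply/rootP; rewrite DE.
    rewrite (bigD1 k) //= qleg_coef_residue addrAC subrr add0r big1 // => j jk.
    rewrite (bigD1 k) //= 1?eq_sym // exprVn divff ?expf_neq0 //.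
    by rewrite subrr mul0r mulr0.
  - rewrite map_inj_uniq ?enum_uniq // => i j ij; apply/val_inj.
    by apply: (ieexprIn p_gt0 _ ij); rewrite gt_eqF.
  - by rewrite size_map size_enum_ord.
have : D.[y] = 0 by rewrite D0 horner0.
rewrite DE => /subr0_eq <-; rewrite mulr_suml; apply: eq_bigr => k _.
rewrite (bigD1 k (P := xpredT)) //=; move: (y0 k) => a.
have : \prod_(l < n.+1 | l != k) (1 - y * p^-1 ^+ l) != 0 by apply/prodf_neq0.
by move: (bigop _ _ _) => z z0; field; rewrite z0.
Qed.

(** Since \sum_j q^(j (k + m + 1)) = 1 / (1 - q^(k + m + 1)), the left side is the integral of P_n
    x^m, and the partial fraction at y = q^(m + 1) evaluates it. For m < n the numerator contains
    the zero factor i = m, which is orthogonality. *)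
Lemma qleg_coef_moment n m :
  \sum_(k < n.+1) qleg_coef n k / (1 - p^-1 ^+ (k + m).+1) =
  (\prod_(i < n) (p^-1 ^+ m.+1 - p^-1 ^+ i.+1)) /
  \prod_(k < n.+1) (1 - p^-1 ^+ m.+1 * p^-1 ^+ k).
Proof.
rewrite -qleg_partial_fraction => [|k].
  by apply: eq_bigr => k _; rewrite -exprD addSn addnC.
rewrite -exprD subr_eq0 gt_eqF // exprVn addSn invf_lt1 ?exprn_gt0 //.
by rewrite exprn_egt1.
Qed.

Lemma qleg_coef_moment_lt n m : (m < n)%N ->
  \sum_(k < n.+1) qleg_coef n k / (1 - p^-1 ^+ (k + m).+1) = 0.
Proof.
move=> mn; rewrite qleg_coef_moment (bigD1 (Ordinal mn)) //=.
by rewrite subrr !mul0r.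
Qed.

(** By orthogonality only the leading term of one factor counts in the integral of P_n^2, so the
    squared norm is the leading coefficient times the n-th moment. *)
Lemma qleg_coef_norm n :
  qleg_coef n n * (\sum_(k < n.+1) qleg_coef n k / (1 - p^-1 ^+ (k + n).+1)) =
  p^-1 ^+ n / (1 - p^-1 ^+ (n + n).+1).
Proof.
have F0 i : qfac p i != 0 by rewrite gt_eqF // qfac_gt0.
rewrite qleg_coef_moment big_ord_recr /= qpoch_inv -exprD addSn.
have -> : \prod_(i < n) (p^-1 ^+ n.+1 - p^-1 ^+ i.+1) =
   (-1) ^+ n * qfac p n / (p ^+ 'C(n.+1, 2) * p ^+ 'C(n.+1, 2)).
  transitivity (\prod_(i < n) (p^-1 ^+ i.+1 * (p^-1 ^+ (n - i) - 1))).
    apply: eq_bigr => i _; rewrite mulrBr mulr1 -exprD; congr (_ ^+ _ - _).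
    by rewrite addSn subnKC // ltnW.
  have := qpoch_inv 0 n; rewrite qfac0 mul0n !add0n mul1r expr1 => E.
  rewrite big_split /= [X in _ * X](eq_bigr (fun i : 'I_n => - (1 - p^-1 ^+ (n
    - i)))); last first.
    by move=> i _; rewrite opprB.
  rewrite prodrN cardT size_enum_ord.
  have -> : \prod_(i < n) (1 - p^-1 ^+ (n - i)) = qfac p n / p ^+ 'C(n.+1, 2).
    rewrite -E (reindex_inj rev_ord_inj) /=; apply: eq_bigr => i _.
    by rewrite -exprS; congr (1 - _ ^+ _); have := ltn_ord i; lia.
  have -> : \prod_(i < n) p^-1 ^+ i.+1 = (p ^+ 'C(n.+1, 2))^-1.
    rewrite -expr_sum exprVn; congr (_ ^+ _)^-1.
    by rewrite -bin2_sum big_mkord big_ord_recl add0n.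
  by rewrite invfM; ring.
rewrite /qleg_coef qbinomn qbinomE ?leq_addl // addnK.
have E : (n * n)%N = ('C(n, 2) + 'C(n.+1, 2))%N.
  by move: (triangular_split n 0); rewrite !addn0 => ->.
rewrite binS bin1 in E *; rewrite E [p^-1 ^+ n]exprVn.
have := sqrr_sign R n; rewrite expr2; move: ((-1) ^+ n) => s ss.
have a := expf_neq0 n p_neq0.
have b := expf_neq0 'C(n, 2) p_neq0.
have c : 1 - p^-1 ^+ (n + n).+1 != 0.
  by rewrite subr_eq0 gt_eqF // exprVn invf_lt1 ?exprn_gt0 // exprn_egt1.
move: (1 - _) c => z z0; rewrite !exprD.
have d := F0 n; have e := F0 (n + n)%N.
transitivity (s * s * ((p ^+ n)^-1 / z)); last by rewrite ss mul1r.
by field; rewrite a b z0 d e.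
Qed.

Lemma qbinom_ge m k : p ^+ (m * k) <= qbinom p (m + k) k.
Proof.
have p1 i : 1 <= p ^+ i by rewrite exprn_ege1 // ltW.
elim: m k => [|m IHm] [|k]; rewrite ?qbinom0 ?muln0 ?expr0 //.
  by rewrite add0n qbinomn.
rewrite addSn qbinomS; apply: le_trans (_ : p ^+ k.+1 * qbinom p (m + k.+1)
  k.+1 <= _).
  by rewrite mulSn exprD ler_pM2l ?exprn_gt0.
by rewrite lerDr qbinom_ge0.
Qed.

Hypothesis p_ge2 : 2 <= p.

Lemma qbinom_le m k : qbinom p (m + k) k <= p ^+ (m * k + m + k).
Proof.
have p1 i : 1 <= p ^+ i by rewrite exprn_ege1 // ltW.
move: {2}(m + k)%N (erefl (m + k)%N) => s.
elim: s m k => [|s IHs] m k E.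
  by have [-> ->] : m = 0%N /\ k = 0%N by lia.
case: m E => [|m] E; first by rewrite add0n qbinomn.
case: k E => [|k] E; first by rewrite addn0 qbinom0.
have E1 : (m.+1 + k = s)%N by lia.
have E2 : (m + k.+1 = s)%N by lia.
have := IHs _ _ E1; have := IHs _ _ E2.
rewrite [(m.+1 + k.+1)%N]addSn qbinomS => H2; rewrite [(m.+1 + k)%N]addSnnS => H1.
(* One less than the target exponent, so that 2 p^e <= p^(e + 1) absorbs the two summands of the
   recursion; this is where 2 <= p enters. *)
set e := (m * k + m.*2 + k.*2).+2.
apply: le_trans (_ : 2 * p ^+ e <= _); last first.
  apply: le_trans (_ : p * p ^+ e <= _); first by rewrite ler_wpM2r //
    exprn_ge0 // ltW.
  by rewrite -exprS ler_weXn2l ?ltW // /e; lia.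
rewrite mulrDl mul1r lerD //.
  by apply: le_trans H1 _; rewrite ler_weXn2l ?ltW // /e; lia.
apply: le_trans (_ : p ^+ k.+1 * p ^+ (m * k.+1 + m + k.+1) <= _).
  by rewrite ler_pM2l ?exprn_gt0.
by rewrite -exprD ler_weXn2l ?ltW // /e; lia.
Qed.

Lemma horner_qlegN n :
  (qleg_poly n).[- p ^+ n] =
  \sum_(k < n.+1) qbinom p n k * qbinom p (n + k) k * p ^+ 'C(k, 2).
Proof. by rewrite horner_qleg; apply: eq_bigr => k _; rewrite qleg_coef_expN. Qed.

Lemma horner_qlegN_ge n :
  p ^+ (n * n + 'C(n, 2)) <= (qleg_poly n).[- p ^+ n].
Proof.
rewrite horner_qlegN big_ord_recr /= qbinomn mul1r exprD -[leLHS]add0r lerD //.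
  apply: sumr_ge0 => k _; rewrite !mulr_ge0 ?qbinom_ge0 ?exprn_ge0 //.
  by rewrite ltW.
by rewrite ler_wpM2r ?qbinom_ge // exprn_ge0 // ltW.
Qed.

Lemma horner_qlegN_le n :
  (qleg_poly n).[- p ^+ n] <= p ^+ (n * n + 'C(n, 2) + 4 * n).
Proof.
have sz : n.+1%:R <= p ^+ n.
  elim: n => // n IHn; rewrite exprS.
  apply: le_trans (_ : 2 * n.+1%:R <= _); first by rewrite -natrM ler_nat; lia.
  by rewrite ler_pM.
rewrite horner_qlegN.
apply: le_trans (_ : \sum_(k < n.+1) p ^+ (n * n + 'C(n, 2) + 3 * n) <= _).
  apply: ler_sum => k _; have kn : (k <= n)%N by rewrite -ltnS.
  have := qbinom_le (n - k) k; rewrite subnK // => H.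
  have q0 := qbinom_ge0.
  have p0 i : 0 <= p ^+ i by rewrite exprn_ge0 // ltW.
  apply: le_trans (ler_pM (mulr_ge0 (q0 _ _) (q0 _ _)) (p0 _) (ler_pM (q0 _ _)
    (q0 _ _) H (qbinom_le n k)) (lexx _)) _.
  rewrite -!exprD ler_weXn2l ?ltW //.
  (* The exponents add up to C(k, 2) + (n - k) k + n k + 2 n + k. [T] bounds the first two by C(n,
     2), and the rest is at most n^2 + 3 n. The fourth n in the statement pays for the number n + 1
     <= p^n of terms. *)
  have T a b : ('C(b, 2) + a * b <= 'C(a + b, 2))%N.
    elim: a => [|a IHa]; first by rewrite mul0n addn0.
    by rewrite addSn binS bin1; move: IHa; lia.
  have := T (n - k)%N k; rewrite subnK //.
  by move: (subnK kn) ('C(_, 2)) ('C(_, 2)); move: (n - k)%N (k : nat) => a b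
    <- c d; nia.
rewrite sumr_const card_ord -mulr_natl.
have -> : (n * n + 'C(n, 2) + 4 * n = n + (n * n + 'C(n, 2) + 3 * n))%N by lia.
rewrite [leRHS]exprD.
by rewrite ler_wpM2r // exprn_ge0 // ltW.
Qed.

End PositiveBase.

(** * The orthogonality measure, the logarithm and the remainder *)

Section QLegendreFunctional.
Variables (R : realType) (p : R).
Hypothesis p_gt1 : 1 < p.

Let p_gt0 : 0 < p. Proof. exact: lt_trans p_gt1. Qed.
Let p_neq0 : p != 0. Proof. exact: lt0r_neq0. Qed.
Let q := p^-1.
Let q_gt0 : 0 < q. Proof. by rewrite invr_gt0. Qed.
Let q_lt1 : q < 1. Proof. by rewrite invf_lt1. Qed.

Lemma expr_invp_lt1 i : q ^+ i.+1 < 1.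
Proof. by rewrite exprn_ilt1 // ?ltW. Qed.

(* Integration of polynomials against the discrete measure with mass q^j at
   q^j, expressed through its moments. *)
Definition qint (f : {poly R}) : R := \sum_(k < size f) f`_k / (1 - q ^+ k.+1).

Lemma qintE N (f : {poly R}) : (size f <= N)%N ->
  qint f = \sum_(k < N) f`_k / (1 - q ^+ k.+1).
Proof.
move=> fN; rewrite /qint (big_ord_widen N (fun k => f`_k / (1 - q ^+ k.+1)) fN).
rewrite big_mkcond; apply: eq_bigr => k _; case: ltnP => // kN.
by rewrite nth_default // mul0r.
Qed.

Lemma qintD f g : qint (f + g) = qint f + qint g.
Proof.
have sfg := size_polyD f g; rewrite (qintE sfg).
rewrite (qintE (leq_maxl (size f) (size g))) (qintE (leq_maxr (size f) (size g))).
by rewrite -big_split; apply: eq_bigr => k _; rewrite coefD mulrDl.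
Qed.

Lemma qintZ a f : qint (a *: f) = a * qint f.
Proof.
rewrite (qintE (size_scale_leq _ _)) mulr_sumr; apply: eq_bigr => k _.
by rewrite coefZ mulrA.
Qed.

Lemma qint0 : qint 0 = 0.
Proof. by rewrite /qint size_poly0 big_ord0. Qed.

Lemma cvg_qint f : series (fun j => f.[q ^+ j] * q ^+ j) @ \oo --> qint f.
Proof.
have H N (a : nat -> R) :
    series (fun j => (\sum_(k < N) a k * (q ^+ j) ^+ k) * q ^+ j) @ \oo -->
    \sum_(k < N) a k / (1 - q ^+ k.+1).
  elim: N => [|N IHN].
    rewrite big_ord0 [X in X @ _](_ : _ = cst 0); first exact: cvg_cst.
    apply/funext => n; rewrite seriesEnat /= big1 // => j _.
    by rewrite big_ord0 mul0r.
  rewrite big_ord_recr /= [X in X @ _](_ : _ =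
    series (fun j => (\sum_(k < N) a k * (q ^+ j) ^+ k) * q ^+ j) +
    series (geometric (a N) (q ^+ N.+1))).
    apply: cvgD => //; apply: cvg_geometric_series.
    by rewrite ger0_norm ?exprn_ge0 ?expr_invp_lt1 // ltW.
  rewrite -seriesD; congr series; apply/funext => j.
  rewrite big_ord_recr /= mulrDl /geometric /=; congr (_ + _).
  by rewrite -mulrA -exprSr -!exprM mulnC.
rewrite /qint [X in series X](_ : _ = (fun j => (\sum_(k < size f) f`_k * (q ^+
  j) ^+ k) * q ^+ j)).
  exact: H.
by apply/funext => j; rewrite horner_coef.
Qed.

Lemma qint_mulXn n m :
  qint (qleg_poly p n * 'X^m) =
  \sum_(k < n.+1) qleg_coef p n k / (1 - q ^+ (k + m).+1).
Proof.
have sz : (size (qleg_poly p n * 'X^m)%R <= m + n.+1)%N.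
  apply: leq_trans (size_polyMleq _ _) _; rewrite size_polyXn addnS /= addnC.
  by rewrite leq_add2l size_poly.
rewrite (qintE sz) big_split_ord /= big1 ?add0r => [|i _].
  apply: eq_bigr => k _; rewrite coefMXn ifF ?addKn; last by lia.
  by rewrite coef_poly ltn_ord addnC.
by rewrite coefMXn ltn_ord mul0r.
Qed.

Lemma qint_sum (I : Type) (r : seq I) (F : I -> {poly R}) :
  qint (\sum_(i <- r) F i) = \sum_(i <- r) qint (F i).
Proof. exact: (big_morph qint qintD qint0). Qed.

Lemma qint_qleg_orth n (g : {poly R}) : (size g <= n)%N ->
  qint (qleg_poly p n * g) = 0.
Proof.
move=> gn; rewrite -[g]coefK poly_def mulr_sumr qint_sum big1 // => i _.
rewrite -scalerAr qintZ qint_mulXn qleg_coef_moment_lt ?mulr0 //.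
exact: leq_trans (ltn_ord i) gn.
Qed.

Lemma qint_qleg_sqr n :
  qint (qleg_poly p n * qleg_poly p n) = q ^+ n / (1 - q ^+ (n + n).+1).
Proof.
rewrite -qleg_coef_norm //.
have E : qleg_poly p n = (\poly_(k < n) qleg_coef p n k) + qleg_coef p n n *: 'X^n.
  by rewrite /qleg_poly !poly_def big_ord_recr.
rewrite {2}E mulrDr qintD qint_qleg_orth ?size_poly // add0r.
by rewrite -scalerAr qintZ qint_mulXn.
Qed.

Lemma little_qLegendreE n x : little_qLegendre q n x = (qleg_poly p n).[x].
Proof.
rewrite horner_qleg; apply: eq_bigr => k _; congr (_ * _).
by rewrite -qleg_coefE // -ltnS.
Qed.

(** The quotient (f(x) - f(y)) / (x - y) as a polynomial in y, by the factorization of x^k - y^k. In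
    this form it can be integrated by [qint] and tested against P_n. *)
Definition diffq_poly (f : {poly R}) (x : R) : {poly R} :=
  \sum_(k < size f) f`_k *: \sum_(i < k) x ^+ (k.-1 - i) *: 'X^i.

Lemma horner_diffq f x y : f.[x] - f.[y] = (x - y) * (diffq_poly f x).[y].
Proof.
rewrite !(horner_coef f) -sumrB /diffq_poly horner_sum mulr_sumr.
apply: eq_bigr => k _; rewrite -mulrBr subrXX mulrCA hornerZ; congr (_ * (_ * _)).
by rewrite horner_sum; apply: eq_bigr => i _; rewrite hornerZ hornerXn.
Qed.

Lemma size_diffq f x : (size (diffq_poly f x) <= (size f).-1)%N.
Proof.
apply: leq_trans (size_sum _ _ _) _; apply/bigmax_leqP => k _.
apply: leq_trans (size_scale_leq _ _) _.
apply: leq_trans (size_sum _ _ _) _; apply/bigmax_leqP => i _.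
apply: leq_trans (size_scale_leq _ _) _.
rewrite size_polyXn; have := ltn_ord k; have := ltn_ord i; lia.
Qed.

Lemma little_qLegendre_assocE n x : (forall j, x != q ^+ j) ->
  little_qLegendre_assoc q n x = qint (diffq_poly (qleg_poly p n) x).
Proof.
move=> xq; apply: cvg_lim => //.
rewrite [X in series X](_ : _ = (fun j => (diffq_poly (qleg_poly p n) x).[q ^+
  j] * q ^+ j)).
  exact: cvg_qint.
apply/funext => j; rewrite /= !little_qLegendreE horner_diffq [(x - _) *
  _]mulrC mulfK //.
by rewrite subr_eq0.
Qed.

Hypothesis p_ge2 : 2 <= p.

(** A row of the double series cut after N terms misses at most q^(N (k + 1)); this bounds all these
    errors together. *)
Lemma geometric_row_le (N : nat) : \sum_(k < N) q ^+ (N * k.+1) <= q ^+ N / (1 - q).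
Proof.
have [->|N0] := posnP N.
  by rewrite big_ord0 expr0 mul1r invr_ge0 subr_ge0 ltW.
apply: le_trans (_ : \sum_(k < N) q ^+ N * q ^+ k <= _).
  apply: ler_sum => k _; rewrite -exprD ler_wiXn2l ?ltW //.
  by rewrite mulnS leq_add2l leq_pmull.
rewrite -mulr_sumr ler_pM2l ?exprn_gt0 // -[leRHS]div1r ler_pdivlMr ?subr_gt0 //.
rewrite mulrC -opprB mulNr -subrX1 opprB gerBl exprn_ge0 // ltW //.
Qed.

(** The denominator is written with w^-1 because w = q^s and w = - q^i turn it into p^s - 1 and -
    (p^i + 1). *)
Lemma sum_exprS (w : R) N : w != 0 -> w != 1 ->
  \sum_(j < N) w ^+ j.+1 = (1 - w ^+ N) / (w^-1 - 1).
Proof.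
move=> w0 w1; under eq_bigr do rewrite exprS.
rewrite -mulr_sumr -[1 - _]opprB subrX1.
move: (bigop _ _ _) => z; have e : 1 - w != 0 by rewrite subr_eq0 eq_sym.
have -> : w^-1 - 1 = (1 - w) / w by rewrite mulrBl div1r divff.
by rewrite invf_div -mulNr opprB mulrC; move: (1 - w) e => v v0; field.
Qed.

(* Expanding 1 / (p^k - 1) and 1 / (p^j + 1) into geometric series turns both
   sums into the same double sum, up to geometric tails. *)
Lemma qlog2_double_sum_le N :
  `|\sum_(k < N) (-1) ^+ k.+1 / (p ^+ k.+1 - 1) + \sum_(j < N) (p ^+ j.+1 + 1)^-1|
  <= 2 * (q ^+ N / (1 - q)).
Proof.
pose D := \sum_(k < N) \sum_(j < N) (-1) ^+ k.+1 * q ^+ (j.+1 * k.+1) : R.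
have pk1 k : 1 <= p ^+ k.+1 - 1.
  rewrite lerBrDr (le_trans p_ge2) // -[leLHS]expr1 ler_weXn2l //.
  exact: ltW.
have qp k : q ^+ k = (p ^+ k)^-1 by rewrite exprVn.
have HA : `|\sum_(k < N) (-1) ^+ k.+1 / (p ^+ k.+1 - 1) - D| <= q ^+ N / (1 - q).
  apply: le_trans (geometric_row_le N).
  rewrite -sumrB; apply: le_trans (ler_norm_sum _ _ _) _; apply: ler_sum => k _.
  rewrite -mulr_sumr -mulrBr normrM normrX normrN1 expr1n mul1r.
  have z1 := pk1 k; have z0 : 0 < p ^+ k.+1 - 1 by apply: lt_le_trans z1.
  under eq_bigr do rewrite mulnC exprM.
  have w0 : q ^+ k.+1 != 0 by rewrite gt_eqF ?exprn_gt0.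
  have w1 : q ^+ k.+1 != 1 by rewrite lt_eqF ?expr_invp_lt1.
  rewrite sum_exprS //.
  rewrite qp invrK mulrBl div1r opprB addrCA subrr addr0 -qp -exprM mulnC.
  rewrite ger0_norm; last by rewrite divr_ge0 ?exprn_ge0 // ltW.
  by rewrite ler_pdivrMr // ler_peMr // exprn_ge0 // ltW.
have HB : `|\sum_(j < N) (p ^+ j.+1 + 1)^-1 + D| <= q ^+ N / (1 - q).
  apply: le_trans (geometric_row_le N).
  rewrite /D exchange_big -big_split /=; apply: le_trans (ler_norm_sum _ _ _)
    _; apply: ler_sum => j _.
  have pj : 0 < p ^+ j.+1 by rewrite exprn_gt0.
  under eq_bigr do rewrite exprM -exprMn mulN1r.
  have qj : 0 < q ^+ j.+1 by rewrite exprn_gt0.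
  have w0 : - q ^+ j.+1 != 0 by rewrite oppr_eq0 gt_eqF.
  have w1 : - q ^+ j.+1 != 1 by rewrite lt_eqF //; lra.
  rewrite sum_exprS //.
  rewrite invrN qp invrK -opprD invrN mulrN mulrBl div1r opprB addrCA subrr addr0.
  rewrite -qp normrM normrX normrN [`|q ^+ _|]gtr0_norm //.
  rewrite -exprM mulnC [X in _ * X]gtr0_norm ?invr_gt0 ?addr_gt0 //.
  by rewrite ler_piMr ?exprn_ge0 ?(ltW q_gt0) // invf_le1 ?addr_gt0 // lerDr ltW.
rewrite mulr2n mulrDl mul1r.
apply: le_trans (lerD HA HB); apply: le_trans (ler_normD _ _).
by rewrite addrACA addNr addr0.
Qed.

Lemma is_cvg_inv_add1 : cvgn (series (fun j => (p ^+ j.+1 + 1)^-1)).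
Proof.
apply: (@series_le_cvg _ _ (geometric 1 q)).
- by move=> j; rewrite invr_ge0 addr_ge0 ?exprn_ge0 // ltW.
- by move=> j; rewrite /geometric /= mul1r exprn_ge0 // ltW.
- move=> j; rewrite /geometric /= mul1r exprVn lef_pV2 ?posrE ?exprn_gt0
  ?addr_gt0 ?exprn_gt0 //.
  rewrite (le_trans (_ : _ <= p ^+ j.+1)) ?lerDl // ler_weXn2l //.
  exact: ltW.
- by apply: is_cvg_geometric_series; rewrite gtr0_norm.
Qed.

Lemma cvg_geometric_tail : (fun N => 2 * (q ^+ N / (1 - q))) @ \oo --> 0.
Proof.
rewrite (_ : (fun _ => _) = geometric (2 / (1 - q)) q).
  by apply: cvg_geometric; rewrite gtr0_norm.
by apply/funext => N; rewrite /geometric /=; ring.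
Qed.

(** Comparing N-th partial sums replaces an exchange of infinite sums, and the convergence of the
    alternating series is inherited from that of the positive one. *)
Lemma cvg_inv_add1 :
  series (fun j => (p ^+ j.+1 + 1)^-1) @ \oo -->
  - limn (series (fun k => (-1) ^+ k.+1 / (p ^+ k.+1 - 1))).
Proof.
set B := (fun j => (p ^+ j.+1 + 1)^-1).
set A := (fun k => (-1) ^+ k.+1 / (p ^+ k.+1 - 1)).
have AB0 : series A + series B @ \oo --> 0.
  apply/cvgr0Pnorm_le => e e0.
  have /cvgr0Pnorm_le/(_ e e0) := cvg_geometric_tail.
  apply: filterS => N; apply: le_trans.
  rewrite !fctE !seriesEord /=; apply: le_trans (qlog2_double_sum_le N) _.
  exact: ler_norm.
have cA : series A @ \oo --> - limn (series B).
  rewrite -[X in _ --> X]add0r (_ : series A = (series A + series B) - series B).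
    by apply: cvgB => //; exact: is_cvg_inv_add1.
  by rewrite addrK.
by rewrite (cvg_lim _ cA) // opprK; exact: is_cvg_inv_add1.
Qed.

Lemma qint_diffq (f : {poly R}) x N : (size f <= N)%N ->
  qint (diffq_poly f x) =
  \sum_(k < N) f`_k * \sum_(i < k) x ^+ (k.-1 - i) / (1 - q ^+ i.+1).
Proof.
move=> fN; pose g k := f`_k * \sum_(i < k) x ^+ (k.-1 - i) / (1 - q ^+ i.+1).
rewrite -/g (_ : \sum_(k < N) _ = \sum_(k < size f) g k); last first.
  rewrite (big_ord_widen N g fN) [RHS]big_mkcond; apply: eq_bigr => k _.
  by case: ltnP => // kN; rewrite /g nth_default // mul0r.
rewrite qint_sum; apply: eq_bigr => k _; rewrite qintZ; congr (_ * _).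
rewrite qint_sum; apply: eq_bigr => i _; rewrite qintZ; congr (_ * _).
rewrite /qint size_polyXn big_ord_recr /= coefXn eqxx div1r big1 ?add0r // => j _.
by rewrite coefXn ltn_eqF ?mul0r.
Qed.

(* Since 1 / (1 - q^s) = p^(n s) / (p^s - 1) - \sum_(1 <= j < n) p^(j s), the
   only non-integral denominators are p^s - 1 and p^i + 1. *)
Lemma qint_diffq_qleg n : (0 < n)%N ->
  qint (diffq_poly (qleg_poly p n) (- p ^+ n)) =
  \sum_(k < n.+1) qbinom p n k * qbinom p (n + k) k * p ^+ 'C(k, 2) *
    \sum_(s < k) (-1) ^+ s.+1 / (p ^+ s.+1 - 1) +
  \sum_(1 <= i < n)
    ((qleg_poly p n).[- p ^+ n] - (qleg_poly p n).[p ^+ (n - i)]) / (p ^+ i + 1).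
Proof.
move=> n0; rewrite (qint_diffq _ (size_poly _ _)).
have pj j : 0 < p ^+ j by rewrite exprn_gt0.
have pn0 : - p ^+ n != 0 by rewrite oppr_eq0 gt_eqF.
(* In [qint_diffq] the power x^(k - s) is x^k / x^s: the factor x^k turns the coefficient into A_k,
   and 1 / x^s with x = - p^n appears here. The index i stands for n - j in the identity above. *)
have E1 s : (0 < s)%N -> (- p ^+ n) ^- s / (1 - q ^+ s) =
    (-1) ^+ s / (p ^+ s - 1) - \sum_(1 <= i < n) (- q ^+ i) ^+ s.
  case: s => // s _; case: n n0 pn0 => // m _ pn0.
  have z0 : p ^+ s.+1 != 0 by rewrite gt_eqF.
  have z1 : p ^+ s.+1 - 1 != 0 by rewrite gt_eqF // expr_sub1_gt0.
  have q0 : q ^+ s.+1 != 0 by rewrite gt_eqF ?exprn_gt0.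
  have q1 : q ^+ s.+1 != 1 by rewrite lt_eqF ?expr_invp_lt1.
  rewrite big_add1 big_mkord /=.
  under eq_bigr do rewrite exprNn -exprM mulnC exprM.
  have -> : (- p ^+ m.+1) ^+ s.+1 = (-1) ^+ s.+1 * (p ^+ s.+1) ^+ m.+1.
    by rewrite [LHS]exprNn -!exprM mulnC.
  rewrite -mulr_sumr sum_exprS // invfM invr_sign.
  rewrite -mulrA -mulrBr; congr (_ * _).
  have -> : q ^+ s.+1 = (p ^+ s.+1)^-1 by rewrite exprVn.
  rewrite invrK exprVn exprS; move: (p ^+ s.+1) z0 z1 => z z0 z1.
  have zm := expf_neq0 m z0; move: (z ^+ m) zm => y y0.
  by field; rewrite z0 z1 y0.
pose A k := qbinom p n k * qbinom p (n + k) k * p ^+ 'C(k, 2).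
transitivity (\sum_(k < n.+1) (A k * \sum_(s < k) (-1) ^+ s.+1 / (p ^+ s.+1 - 1) -
  \sum_(1 <= i < n) A k * \sum_(s < k) (- q ^+ i) ^+ s.+1)).
  apply: eq_bigr => k _; rewrite coef_poly ltn_ord -mulr_sumr -mulrBr
    exchange_big /=.
  rewrite -sumrB /A -qleg_coef_expN // -[RHS]mulrA; congr (_ * _).
  rewrite mulr_sumr; apply: eq_bigr => s _; rewrite -E1 // mulrA; congr (_ / _).
  have -> : (k.-1 - s = k - s.+1)%N by have := ltn_ord s; lia.
  by rewrite exprB ?unitfE.
rewrite sumrB exchange_big /= -sumrN; congr (_ + _).
rewrite big_seq [RHS]big_seq; apply: eq_bigr => i;
  rewrite mem_index_iota => /andP[i0 iln].
rewrite horner_qlegN // horner_qleg -sumrB mulr_suml -sumrN; apply: eq_bigr => k _.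
have w0 : - q ^+ i != 0 by rewrite oppr_eq0 gt_eqF ?exprn_gt0.
have w1 : - q ^+ i != 1 by rewrite lt_eqF // (lt_trans (_ : _ < 0)) ?oppr_lt0
  ?exprn_gt0.
(* The geometric sum over s leaves (- q^i)^k beside A_k. The two signs cancel, hence the values of
   P_n at positive powers of p. *)
have -> : p ^+ (n - i) = - p ^+ n * - q ^+ i.
  by rewrite mulrNN expfB // exprVn.
rewrite exprMn mulrA qleg_coef_expN // -/(A k) sum_exprS // invrN exprVn invrK.
have z0 : p ^+ i + 1 != 0 by rewrite gt_eqF ?addr_gt0.
by rewrite -opprD invrN mulrN mulrN opprK mulrA mulrBr mulr1.
Qed.

Let qlog : R := limn (series (fun k => (-1) ^+ k.+1 / (p ^+ k.+1 - 1))).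

Lemma cvg_stieltjes n : (0 < n)%N ->
  series (fun j => q ^+ j / (- p ^+ n - q ^+ j)) @ \oo -->
  qlog + \sum_(1 <= k < n) (p ^+ k + 1)^-1.
Proof.
case: n => // m _; pose B := fun j => (p ^+ j.+1 + 1)^-1.
(* The j-th term is - 1 / (p^(n + j) + 1), so with n = m + 1 the partial sums are those of - [B]
   shifted by m. *)
have -> : series (fun j => q ^+ j / (- p ^+ m.+1 - q ^+ j)) =
   (fun N => - series B (N + m)%N) + cst (series B m).
  apply/funext => N; rewrite [RHS]/GRing.add /= series_addn opprD addrAC addNr
    add0r.
  rewrite -[X in - \sum_(X <= _ < _) _]add0n big_addn addnK big_mkord
    seriesEord /= -sumrN.
  apply: eq_bigr => j _; rewrite /B -addnS exprD [q ^+ j]exprVn -opprD invrN mulrN.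
  by rewrite -invfM mulrDr divff // expf_neq0.
rewrite big_add1 big_mkord /=; apply: cvgD.
  rewrite -[qlog]opprK; apply: cvgN.
  rewrite (cvg_shiftn m (series B)); exact: cvg_inv_add1.
by rewrite seriesEord; exact: cvg_cst.
Qed.

Lemma qleg_remainder_bounds n : (0 < n)%N ->
  let P := (qleg_poly p n).[- p ^+ n] in
  let r := P * (P * (qlog + \sum_(1 <= k < n) (p ^+ k + 1)^-1)
                - qint (diffq_poly (qleg_poly p n) (- p ^+ n))) in
  let h := q ^+ n / (1 - q ^+ (n + n).+1) in
  - (h / p ^+ n) <= r /\ r <= - (h / (p ^+ n + 1)).
Proof.
move=> n0 P r h; set x := - p ^+ n in P r *; set T := diffq_poly _ _ in r *.
have pn : 0 < p ^+ n by rewrite exprn_gt0.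
have xq j : x - q ^+ j < 0 by rewrite subr_lt0 /x (lt_trans (_ : _ < 0))
  ?oppr_lt0 ?exprn_gt0.
pose S := series (fun j => (qleg_poly p n).[q ^+ j] ^+ 2 * q ^+ j / (x - q ^+ j)).
have cS : S @ \oo --> r.
  (* With u = x - q^j and P_n(q^j) = P - u T(q^j), the quotient P_n(q^j)^2 / u is P^2 / u - P T(q^j)
     - P_n(q^j) T(q^j). The last part integrates to 0 because T has degree below n. *)
  have E : S = (P * P) *: series (fun j => q ^+ j / (x - q ^+ j)) -
         P *: series (fun j => T.[q ^+ j] * q ^+ j) -
         series (fun j => (qleg_poly p n * T).[q ^+ j] * q ^+ j).
    rewrite -!seriesZ -!seriesN -!seriesD; congr series; apply/funext => j.
    rewrite !fctE /= /GRing.scale /= hornerM.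
    have := horner_diffq (qleg_poly p n) x (q ^+ j); rewrite -/P -/T.
    move: (_.[q ^+ j]) (T.[_]) => a b ab.
    have := xq j; move=> /lt_eqF/negbT xj.
    have {ab}-> : b = (P - a) / (x - q ^+ j) by rewrite ab mulrAC divff ?mul1r.
    by field.
  rewrite E.
  have -> : r = P * P * (qlog + \sum_(1 <= k < n) (p ^+ k + 1)^-1) - P * qint T
    - qint (qleg_poly p n * T).
    rewrite qint_qleg_orth ?subr0; first by rewrite /r mulrBr mulrA.
    apply: leq_trans (size_diffq _ _) _; rewrite -subn1 leq_subLR add1n.
    exact: size_poly.
  apply: cvgB; last exact: cvg_qint.
  apply: cvgB; last by apply: cvgZl_tmp; exact: cvg_qint.
  by apply: cvgZl_tmp; exact: cvg_stieltjes.
have cH : series (fun j => (qleg_poly p n * qleg_poly p n).[q ^+ j] * q ^+ j) @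
  \oo --> h.
  by rewrite /h -qint_qleg_sqr; exact: cvg_qint.
have qj1 j : q ^+ j <= 1 by rewrite exprn_ile1 // ltW.
have qj0 j : 0 < q ^+ j by rewrite exprn_gt0.
have SE N c : series (fun j => (qleg_poly p n * qleg_poly p n).[q ^+ j] * q ^+
  j) N * c =
   \sum_(j < N) (qleg_poly p n).[q ^+ j] ^+ 2 * q ^+ j * c.
  by rewrite seriesEord /= mulr_suml; apply: eq_bigr => j _; rewrite hornerM.
have w0 j : 0 <= (qleg_poly p n).[q ^+ j] ^+ 2 * q ^+ j.
  by rewrite mulr_ge0 ?sqr_ge0 // ltW.
have xE j : (x - q ^+ j)^-1 = - (p ^+ n + q ^+ j)^-1 by rewrite -opprD invrN.
(* Both bounds compare x - q^j = - (p^n + q^j), using 0 < q^j <= 1, with a constant that factors out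
   of the integral of P_n^2. *)
split; rewrite -mulrN.
  apply: (ler_cvg_to (cvgMr_tmp (b := - (p ^+ n)^-1) cH) cS).
  near=> N; rewrite SE /S seriesEord; apply: ler_sum => j _.
  rewrite ler_wpM2l // xE lerN2 lef_pV2 ?posrE ?addr_gt0 //.
  by rewrite lerDl ltW.
apply: (ler_cvg_to cS (cvgMr_tmp (b := - (p ^+ n + 1)^-1) cH)).
near=> N; rewrite SE /S seriesEord; apply: ler_sum => j _.
rewrite ler_wpM2l // xE lerN2 lef_pV2 ?posrE ?addr_gt0 //.
by rewrite lerD2l.
Unshelve. all: end_near.
Qed.

End QLegendreFunctional.

(** * Products of cyclotomic values and their logarithms *)

Lemma perm_filter_divisors n k : (0 < k <= n)%N ->
  perm_eq [seq d <- index_iota 1 n.+1 | (d %| k)%N] (divisors k).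
Proof.
case/andP=> k0 kn; apply: uniq_perm.
- by rewrite filter_uniq // iota_uniq.
- exact: divisors_uniq.
move=> d; rewrite mem_filter mem_index_iota -dvdn_divisors //.
case: (boolP (d %| k)%N) => //= dk.
by rewrite ltnS (leq_trans (dvdn_leq k0 dk) kn) (dvdn_gt0 k0 dk).
Qed.

Lemma ln_prod_seq (R : realType) (I : eqType) (r : seq I) (F : I -> R) :
  (forall i, i \in r -> 0 < F i) ->
  ln (\prod_(i <- r) F i) = \sum_(i <- r) ln (F i).
Proof.
elim: r => [|i r IHr] F0; first by rewrite !big_nil ln1.
rewrite !big_cons lnM ?posrE ?IHr ?F0 ?mem_head // => [j jr|].
  by rewrite F0 // inE jr orbT.
by rewrite big_seq; apply: prodr_gt0 => j jr; rewrite F0 // inE jr orbT.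
Qed.

Section CyclotomicProduct.
Variable m : int.
Hypothesis m_ge2 : 2 <= m.

Lemma prod_Cyclotomic_horner k : (0 < k)%N ->
  \prod_(d <- divisors k) ('Phi_d).[m] = m ^+ k - 1.
Proof.
move=> k0; rewrite -horner_prod prod_Cyclotomic //.
by rewrite hornerD hornerXn hornerN hornerC.
Qed.

Lemma Cyclotomic_horner_gt0 k : (0 < k)%N -> 0 < ('Phi_k).[m].
Proof.
elim/ltn_ind: k => k IHk k0; have := prod_Cyclotomic_horner k0.
have m1 : 1 < m by apply: lt_le_trans m_ge2.
have : 0 < m ^+ k - 1 by rewrite subr_gt0 exprn_egt1 // -lt0n.
rewrite (bigD1_seq k) ?divisors_uniq ?divisors_id //= => + H;
  rewrite -H pmulr_lgt0 //.
rewrite big_seq_cond; apply: prodr_gt0 => d /andP[dk nk].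
rewrite -dvdn_divisors // in dk; apply: IHk; last exact: dvdn_gt0 dk.
by rewrite ltn_neqAle nk dvdn_leq.
Qed.

Lemma cyclotomic_prod_gt0 n : 0 < cyclotomic_prod n m.
Proof.
rewrite /cyclotomic_prod big_seq; apply: prodr_gt0 => k.
by rewrite mem_index_iota => /andP[k0 _]; apply: Cyclotomic_horner_gt0.
Qed.

Lemma dvdz_cyclotomic_prod n k : (0 < k <= n)%N ->
  (m ^+ k - 1 %| cyclotomic_prod n m)%Z.
Proof.
case/andP=> k0 kn; rewrite -prod_Cyclotomic_horner // /cyclotomic_prod.
have -> : \prod_(1 <= d < n.+1) ('Phi_d).[m] =
    \prod_(d <- divisors k) ('Phi_d).[m] *
    \prod_(1 <= d < n.+1 | ~~ (d %| k)%N) ('Phi_d).[m].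
  rewrite (bigID (fun d => d %| k)%N) /=; congr (_ * _).
  rewrite -big_filter; apply/perm_big/perm_filter_divisors.
  by rewrite k0.
exact: dvdz_mulr.
Qed.

End CyclotomicProduct.

(** Both sides count each f d once for every e >= 1 with e d <= N. *)
Lemma sum_floor_exchange (R : pzRingType) (f : nat -> R) N :
  \sum_(1 <= e < N.+1) \sum_(1 <= d < (N %/ e).+1) f d =
  \sum_(1 <= d < N.+1) f d *+ (N %/ d).
Proof.
transitivity (\sum_(1 <= e < N.+1) \sum_(1 <= d < N.+1 | (e * d <= N)%N) f d).
  rewrite big_seq [RHS]big_seq; apply: eq_bigr => e;
    rewrite mem_index_iota => /andP[e0 _].
  rewrite (big_nat_widen _ _ N.+1) ?ltnS ?leq_div //.
  by apply: eq_bigl => d /=; rewrite ltnS leq_divRL // mulnC.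
rewrite (exchange_big_dep xpredT) //= big_seq [RHS]big_seq; apply: eq_bigr => d.
rewrite mem_index_iota => /andP[d0 _].
rewrite (eq_bigl (fun e => xpredT e && (e < (N %/ d).+1)%N)); last first.
  by move=> e /=; rewrite ltnS leq_divRL.
rewrite -(big_nat_widen 1 (N %/ d).+1 N.+1) ?ltnS ?leq_div //.
by rewrite big_const_nat subn1 /= iter_addr_0.
Qed.

Section LogCyclotomicProduct.
Variables (R : realType) (m : int).
Hypothesis m_ge2 : 2 <= m.

Definition log_cyclotomic_prod n : R := ln (cyclotomic_prod n m)%:~R.

Let lam d : R := ln (('Phi_d).[m])%:~R.

Lemma log_cyclotomic_prodE n :
  log_cyclotomic_prod n = \sum_(1 <= d < n.+1) lam d.
Proof.
rewrite /log_cyclotomic_prod.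
elim: n => [|n IHn]; first by rewrite /cyclotomic_prod !big_geq // ln1.
rewrite /cyclotomic_prod !(big_nat_recr n.+1) //= rmorphM lnM ?posrE ?ltr0z //.
- by rewrite -IHn.
- exact: cyclotomic_prod_gt0.
- exact: Cyclotomic_horner_gt0.
Qed.

Lemma log_cyclotomic_prod_ge0 n : 0 <= log_cyclotomic_prod n.
Proof. by apply: ln_ge0; rewrite ler1z; exact: cyclotomic_prod_gt0. Qed.

(** After the exchange each Phi_d counts N %/ d times, once for each multiple of d up to N. The
    induction uses that N %/ d grows by one exactly when d divides N + 1. *)
Lemma sum_log_cyclotomic_prod N :
  \sum_(1 <= e < N.+1) log_cyclotomic_prod (N %/ e) =
  \sum_(1 <= k < N.+1) ln (m%:~R ^+ k - 1).
Proof.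
under eq_bigr do rewrite log_cyclotomic_prodE.
rewrite sum_floor_exchange.
elim: N => [|N IHN]; first by rewrite !big_geq.
rewrite [in RHS]big_nat_recr //= -IHN.
transitivity (\sum_(1 <= d < N.+2) (lam d *+ (N %/ d) + lam d *+ (d %| N.+1)%N)).
  rewrite big_seq [RHS]big_seq; apply: eq_bigr => d;
    rewrite mem_index_iota => /andP[d0 _].
  by rewrite divnS // mulrnDr addrC.
rewrite big_split big_nat_recr //= divn_small // mulr0n addr0; congr (_ + _).
have -> : m%:~R ^+ N.+1 - 1 = (m ^+ N.+1 - 1)%:~R :> R.
  by rewrite rmorphB rmorphXn.
rewrite -prod_Cyclotomic_horner // rmorph_prod /=.
have -> : ln (\prod_(d <- divisors N.+1) (('Phi_d).[m])%:~R) = \sum_(d <-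
  divisors N.+1) lam d.
  apply: ln_prod_seq => d; rewrite -dvdn_divisors // => /dvdn_gt0 d0.
  by rewrite ltr0z Cyclotomic_horner_gt0 // d0.
under eq_bigr do rewrite mulrb.
rewrite -big_mkcond -big_filter; apply/perm_big/perm_filter_divisors.
by rewrite leqnn.
Qed.

(** The estimate m^k - 1 >= m^k / 2 costs ln 2 <= ln m per term, and the sum of the k exceeds N^2 /
    2 by N / 2 only. *)
Lemma sum_ln_expr_sub1 N :
  `|\sum_(1 <= k < N.+1) ln (m%:~R ^+ k - 1) - ln m%:~R / 2 * N%:R ^+ 2| <=
  ln m%:~R * N%:R :> R.
Proof.
have M2 : 2 <= m%:~R :> R by rewrite (_ : 2 = 2%:~R) ?ler_int.
set M : R := m%:~R in M2 *; set L := ln M.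
have L2 : ln 2 <= L by rewrite ler_ln ?posrE // (lt_le_trans _ M2).
have l2 : 0 <= ln 2 :> R by apply: ln_ge0; rewrite ler1n.
have M0 : 0 < M by apply: lt_le_trans M2.
elim: N => [|N IHN]; first by rewrite big_geq // expr0n !mulr0 subrr normr0.
rewrite big_nat_recr //=.
have Mk : 2 <= M ^+ N.+1.
  by rewrite (le_trans M2) // -[leLHS]expr1 ler_weXn2l // (le_trans _ M2) // ler1n.
have Mk0 : 0 < M ^+ N.+1 - 1 by lra.
have up : ln (M ^+ N.+1 - 1) <= N.+1%:R * L.
  rewrite mulr_natl -lnXn // ler_ln ?posrE ?exprn_gt0 //; lra.
have lo : N.+1%:R * L - ln 2 <= ln (M ^+ N.+1 - 1).
  rewrite mulr_natl -lnXn // -ln_div ?posrE ?exprn_gt0 // ler_ln ?posrE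
    ?divr_gt0 ?exprn_gt0 //; lra.
move: IHN; rewrite !ler_norml -natr1 in up lo *.
move: (bigop _ _ _) (ln _) up lo => s t up lo /andP[h1 h2].
by apply/andP; split; nra.
Qed.

End LogCyclotomicProduct.

(** * Inversion of floor sums *)

Section FloorSums.
Variable R : realType.

Definition harmonic_sum N : R := \sum_(1 <= e < N.+1) e%:R^-1.

Lemma inv_sqr_le_telescope n : (0 < n)%N ->
  (n.+1%:R ^+ 2)^-1 <= n%:R^-1 - n.+1%:R^-1 :> R.
Proof.
rewrite -(ltr0n R) -(natr1 n); move: (n%:R : R) => x x0.
rewrite -subr_ge0.
have -> : x^-1 - (x + 1)^-1 - ((x + 1) ^+ 2)^-1 = (x * (x + 1) ^+ 2)^-1.
  by field; rewrite !gt_eqF // addr_gt0.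
by rewrite invr_ge0 mulr_ge0 ?exprn_ge0 ?addr_ge0 // ltW.
Qed.

Lemma sum_inv_sqr_tail_le m N : (0 < m <= N)%N ->
  \sum_(m.+1 <= e < N.+1) (e%:R ^+ 2)^-1 <= m%:R^-1 - N%:R^-1 :> R.
Proof.
case/andP=> m0; elim: N => [|N IHN] mN; first by have := leq_trans m0 mN.
have [->|] := eqVneq m N.+1; first by rewrite big_geq // subrr.
move=> mN'; have {}mN : (m <= N)%N by rewrite -ltnS ltn_neqAle mN'.
rewrite big_nat_recr //=; apply: le_trans (lerD (IHN mN) (inv_sqr_le_telescope
  _)) _.
  exact: leq_trans m0 mN.
by rewrite addrA subrK.
Qed.

Lemma sum_inv_sqr_le N : \sum_(1 <= e < N.+1) (e%:R ^+ 2)^-1 <= 2 :> R.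
Proof.
case: N => [|N]; first by rewrite big_geq.
rewrite big_ltn // expr1n invr1.
have : 0 <= N.+1%:R^-1 :> R by rewrite invr_ge0.
have := @sum_inv_sqr_tail_le 1 N.+1 isT; rewrite invr1.
by move: (_^-1) (bigop _ _ _) => x y; lra.
Qed.

(** The term e = 2 gives 1 / 4 and the telescoping tail at most 1 / 2. What counts is a bound below
    1. *)
Lemma sum_inv_sqr_from2_le N :
  \sum_(2 <= e < N.+1) (e%:R ^+ 2)^-1 <= 3 / 4 :> R.
Proof.
case: N => [|[|N]]; [by rewrite big_geq //; lra|by rewrite big_geq //; lra|].
rewrite big_ltn //.
have : 0 <= N.+2%:R^-1 :> R by rewrite invr_ge0.
have := @sum_inv_sqr_tail_le 2 N.+2 isT.
by move: (N.+2%:R^-1) (bigop _ _ _) => x y; lra.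
Qed.

(** Completing a square gives x <= d + x^2 / (4 d) for x = 1 / e, and the x^2 sum to at most 2. *)
Lemma harmonic_sum_le (d : R) : 0 < d ->
  exists C : R, forall N, harmonic_sum N <= d * N%:R + C.
Proof.
move=> d0; exists (2 / (4 * d)) => -[|N]; first by rewrite /harmonic_sum
  big_geq // mulr0 add0r divr_ge0 // mulr_ge0 // ltW.
apply: le_trans (_ : \sum_(1 <= e < N.+2) (d + (e%:R ^+ 2)^-1 / (4 * d)) <= _).
  apply: ler_sum_nat => e /andP[e0 _].
  have x0 : 0 < e%:R^-1 :> R by rewrite invr_gt0 ltr0n.
  rewrite -exprVn; move: (_^-1) x0 => x x0.
  rewrite -subr_ge0 (_ : _ - _ = (x - 2 * d) ^+ 2 / (4 * d)); last by field;
    rewrite gt_eqF.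
  by rewrite divr_ge0 ?sqr_ge0 // mulr_ge0 // ltW.
rewrite big_split /= sumr_const_nat subn1 /= -mulr_suml mulr_natr lerD //.
rewrite ler_pM2r ?invr_gt0 ?mulr_gt0 //.
exact: sum_inv_sqr_le.
Qed.

(** From |E(N)| <= s N^2 + O(N) the recursion gives 3 s / 4, by the sum of the 1 / e^2, and a
    further s / 20 absorbs the terms of size N times a harmonic sum. So s improves to 4 s / 5, and
    iteration from the a priori bound reaches any eps; the linear constant changes at each step and
    hence depends on eps. *)
Lemma floor_contraction (E : nat -> R) (K : R) : 0 <= K ->
  (forall N, `|E N| <= K * N%:R * (1 + harmonic_sum N)
     + \sum_(2 <= e < N.+1) `|E (N %/ e)%N|) ->
  (exists B, forall N, `|E N| <= B * N%:R ^+ 2) ->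
  forall eps, 0 < eps -> exists C, forall N, `|E N| <= eps * N%:R ^+ 2 + C * N%:R.
Proof.
move=> K0 HE [B0 HB].
have fl N e : (N %/ e)%:R <= N%:R / e%:R :> R.
  have [->|e0] := posnP e; first by rewrite divn0 invr0 mulr0.
  by rewrite ler_pdivlMr ?ltr0n // -natrM ler_nat leq_trunc_div.
have step s : 0 < s -> (exists C, forall N, `|E N| <= s * N%:R ^+ 2 + C * N%:R) ->
   exists C, forall N, `|E N| <= 4 / 5 * s * N%:R ^+ 2 + C * N%:R.
  move=> s0 [C0 HC0].
  pose C := Num.max C0 0.
  have C0' : 0 <= C by rewrite le_max lexx orbT.
  have HC N : `|E N| <= s * N%:R ^+ 2 + C * N%:R.
    by apply: le_trans (HC0 N) _; rewrite lerD2l ler_wpM2r // le_max lexx.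
  pose d := s / 20 / (K + C + 1).
  have KC : 0 < K + C + 1 by lra.
  have d0 : 0 < d by rewrite !divr_gt0.
  have [D HD] := harmonic_sum_le d0.
  exists (K + (K + C) * D) => N.
  have T : \sum_(2 <= e < N.+1) `|E (N %/ e)%N| <= s * N%:R ^+ 2 * (3 / 4) + C
    * N%:R * harmonic_sum N.
    apply: le_trans (_ : \sum_(2 <= e < N.+1) (s * N%:R ^+ 2 * (e%:R ^+ 2)^-1 +
      C * N%:R * e%:R^-1) <= _).
      apply: ler_sum_nat => e _; apply: le_trans (HC _) _.
      have f2 : (N %/ e)%:R ^+ 2 <= N%:R ^+ 2 / e%:R ^+ 2 :> R.
        by rewrite -exprVn -exprMn ler_sqr ?nnegrE ?divr_ge0.
      apply: lerD; rewrite -[leRHS]mulrA ler_wpM2l //.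
      exact: ltW.
    rewrite big_split /= -!mulr_sumr lerD //.
      by rewrite ler_wpM2l ?sum_inv_sqr_from2_le // mulr_ge0 ?exprn_ge0 // ltW.
    rewrite ler_wpM2l ?mulr_ge0 // /harmonic_sum.
    case: N => [|N]; first by rewrite !big_geq.
    by rewrite [leRHS]big_ltn // lerDr invr_ge0.
  apply: le_trans (HE N) _; apply: le_trans (lerD (lexx _) T) _.
  have Nh : N%:R * harmonic_sum N <= N%:R * (d * N%:R + D) by rewrite ler_wpM2l.
  have dE : d * (K + C + 1) = s / 20 by rewrite /d divfK // gt_eqF.
  have N0 : 0 <= N%:R :> R by [].
  move: (harmonic_sum N) (N%:R : R) N0 Nh => h x x0 xh.
  have y0 := mulr_ge0 x0 x0.
  have H1 : (K + C) * (x * h) <= (K + C) * (x * (d * x + D)) by rewrite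
    ler_wpM2l // addr_ge0.
  have H2 : (K + C) * d <= s / 20 by rewrite -dE; nra.
  have H3 : (K + C) * d * (x * x) <= s / 20 * (x * x) by rewrite ler_wpM2r.
  nra.
move=> eps eps0.
pose B := Num.max B0 1.
have B0' : 0 < B by rewrite lt_max ltr01 orbT.
have it i : exists C, forall N, `|E N| <= B * (4 / 5) ^+ i * N%:R ^+ 2 + C * N%:R.
  elim: i => [|i IHi].
    exists 0 => N; rewrite expr0 mulr1 mul0r addr0.
    by apply: le_trans (HB N) _; rewrite ler_wpM2r ?exprn_ge0 // le_max lexx.
  rewrite exprS mulrCA; apply: step => //.
  by rewrite mulr_gt0 ?exprn_gt0 // divr_gt0.
have [i Hi] : exists i, B * (4 / 5) ^+ i <= eps.
  have := @cvg_geometric R B (4 / 5); rewrite ger0_norm ?divr_ge0 // => /(_ _).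
  have h : (4 / 5 : R) < 1 by lra.
  move=> /(_ h) /cvgr0_norm_le /(_ _ eps0) [i _ /(_ i (leqnn _))] /= H.
  by exists i; apply: le_trans H; exact: ler_norm.
have [C HC] := it i; exists C => N; apply: le_trans (HC N) _.
by rewrite lerD2r ler_wpM2r ?exprn_ge0.
Qed.

(** With x = N / e the difference of x^2 and the square of its floor lies between 0 and 2 x. *)
Lemma sum_floor_sqr_bounds N :
  0 <= (N%:R : R) ^+ 2 * (\sum_(1 <= e < N.+1) (e%:R ^+ 2)^-1)
    - \sum_(1 <= e < N.+1) (N %/ e)%:R ^+ 2 <= 2 * N%:R * harmonic_sum N.
Proof.
rewrite mulr_sumr -sumrB /harmonic_sum mulr_sumr; apply/andP; split.
  rewrite big_seq; apply: sumr_ge0 => e; rewrite mem_index_iota => /andP[e0 _].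
  rewrite -exprVn -exprMn subr_ge0 ler_sqr ?nnegrE ?divr_ge0 //.
  by rewrite ler_pdivlMr ?ltr0n // -natrM ler_nat leq_trunc_div.
apply: ler_sum_nat => e /andP[e0 _]; rewrite -exprVn -exprMn -mulrA.
have le1 : (N %/ e)%:R <= N%:R / e%:R :> R.
  by rewrite ler_pdivlMr ?ltr0n // -natrM ler_nat leq_trunc_div.
have le2 : N%:R / e%:R <= (N %/ e)%:R + 1 :> R.
  by rewrite ler_pdivrMr ?ltr0n // natr1 -natrM ler_nat ltnW // ltn_ceil.
have y0 : 0 <= (N %/ e)%:R :> R by [].
move: (_ / _) (_%:R) y0 le1 le2 => x y y0 le1 le2; nra.
Qed.

(** Here z stands for zeta(2), known through its partial sums. With c = a / z the function c N^2 has
    the floor sum a N^2, up to N times a harmonic sum, so the floor sums of E = L - c N^2 are small;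
    isolating the term e = 1 gives the recursion of [floor_contraction]. As L is nonnegative, L N is
    at most its own floor sum, which is the a priori bound. *)
Lemma floor_sum_inversion (L : nat -> R) (a C z : R) :
  0 <= a -> 0 <= C -> L 0%N = 0 -> (forall N, 0 <= L N) ->
  (forall N, `|\sum_(1 <= e < N.+1) L (N %/ e)%N - a * N%:R ^+ 2| <= C * N%:R) ->
  (forall N, (0 < N)%N ->
    \sum_(1 <= e < N.+1) (e%:R ^+ 2)^-1 <= z
      <= \sum_(1 <= e < N.+1) (e%:R ^+ 2)^-1 + N%:R^-1) ->
  forall eps, 0 < eps ->
    exists B, forall N, `|L N - a / z * N%:R ^+ 2| <= eps * N%:R ^+ 2 + B * N%:R.
Proof.
move=> a0 C0 L0 Lp HS Hz.
have z1 : 1 <= z by have /andP[] := Hz 1%N isT; rewrite big_nat1 expr1n invr1.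
have zp : 0 < z by apply: lt_le_trans z1.
set c := a / z; have c0 : 0 <= c by rewrite divr_ge0 // ltW.
have cz : c * z = a by rewrite divfK // gt_eqF.
have NN N : N%:R <= N%:R ^+ 2 :> R.
  by rewrite -natrX ler_nat; case: N => // N; rewrite leq_pmulr.
apply: (@floor_contraction _ (C + 2 * c)); first by rewrite addr_ge0 // mulr_ge0.
- case=> [|N].
    by rewrite L0 expr0n mulr0 subr0 normr0 big_geq // mulr0 mul0r addr0.
  have -> : L N.+1 - c * N.+1%:R ^+ 2 =
    (\sum_(1 <= e < N.+2) L (N.+1 %/ e)%N - c * \sum_(1 <= e < N.+2) (N.+1 %/
      e)%:R ^+ 2)
     - \sum_(2 <= e < N.+2) (L (N.+1 %/ e)%N - c * (N.+1 %/ e)%:R ^+ 2).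
    rewrite sumrB -mulr_sumr [in LHS](_ : L N.+1 = L (N.+1 %/ 1)%N) ?divn1 //.
    rewrite [in RHS]big_ltn // [X in _ - c * X - _]big_ltn // divn1; ring.
  apply: le_trans (ler_normB _ _) _; apply: lerD; last exact: ler_norm_sum.
  have := HS N.+1; have /andP[f1 f2] := sum_floor_sqr_bounds N.+1.
  have /andP[z2 z3] := Hz N.+1 isT.
  have n0 : 0 < N.+1%:R :> R by [].
  have z3' : N.+1%:R ^+ 2 * z <= N.+1%:R ^+ 2 * \sum_(1 <= e < N.+2) (e%:R ^+
    2)^-1 + N.+1%:R.
    have := ler_wpM2l (exprn_ge0 2 (ltW n0)) z3.
    by rewrite mulrDr [X in _ + X](_ : _ = N.+1%:R) // expr2 mulfK // gt_eqF.
  have z2' : N.+1%:R ^+ 2 * \sum_(1 <= e < N.+2) (e%:R ^+ 2)^-1 <= N.+1%:R ^+ 2 * z.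
    by rewrite ler_wpM2l // exprn_ge0.
  have h0 : 0 <= harmonic_sum N.+1 by apply: sumr_ge0 => e _; rewrite invr_ge0.
  move: f1 f2 z3' z2' n0 h0.
  move: (harmonic_sum _) (N.+1%:R ^+ 2 * bigop _ _ _) => h W.
  move: (\sum_(1 <= e < N.+2) (N.+1 %/ e)%:R ^+ 2) (\sum_(1 <= e < N.+2) L
    (N.+1 %/ e)%N) => U V.
  rewrite !ler_norml => f1 f2 z3' z2' n0 h0 /andP[g1 g2].
  have h1 : 0 <= N.+1%:R ^+ 2 * z - U <= N.+1%:R * (1 + 2 * h) by apply/andP;
    split; nra.
  have h2 : 0 <= c * (N.+1%:R ^+ 2 * z - U) <= c * (N.+1%:R * (1 + 2 * h)).
    by case/andP: h1 => h1 h2; rewrite mulr_ge0 //= ler_wpM2l.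
  have nh : 0 <= N.+1%:R * h by rewrite mulr_ge0 // ltW.
  have cn := mulr_ge0 c0 (ltW n0); have cnh := mulr_ge0 c0 nh.
  have Cnh := mulr_ge0 C0 nh; have Cn := mulr_ge0 C0 (ltW n0).
  have ca : c * (N.+1%:R ^+ 2 * z) = a * N.+1%:R ^+ 2 by rewrite -cz; ring.
  rewrite mulrBr ca in h2; case/andP: h2 => h2 h3.
  move: g1 g2 h2 h3 cn cnh Cnh Cn; clear.
  move: (_ ^+ 2) => x2; move: (_%:R) => x g1 g2 h2 h3 cn cnh Cnh Cn.
  by apply/andP; split; lra.
- exists (a + C + c) => N; apply: le_trans (ler_normB _ _) _.
  have cN : 0 <= c * N%:R ^+ 2 by rewrite mulr_ge0 // exprn_ge0.
  rewrite (ger0_norm (Lp N)) (ger0_norm cN) [leRHS]mulrDl lerD2r.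
  have [->|N0] := posnP N; first by rewrite L0 expr0n mulr0.
  have : L N <= \sum_(1 <= e < N.+1) L (N %/ e)%N.
    by rewrite big_ltn // divn1 lerDl sumr_ge0.
  have := HS N; rewrite ler_norml => /andP[_ g2] g3; have := NN N.
  move: (bigop _ _ _) (N%:R ^+ 2) g2 g3 => S x2 g2 g3 g4.
  by nra.
Qed.

End FloorSums.

(** * Sine and cosine estimates, zeta(2), and rational bounds for pi *)

Section TrigonometricBounds.
Variable R : realType.
Implicit Type x : R.

Let alternating_sum_lt (f : R^nat) (l : R) n :
  series f @ \oo --> l ->
  (forall d, 0 < (-1) ^+ n * (f (n + d.*2)%N + f (n + d.*2.+1)%N)) ->
  (-1) ^+ n * \sum_(i < n) f i < (-1) ^+ n * l.
Proof.
move=> fl H; pose g i := (-1) ^+ n * f i.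
have gl : series g @ \oo --> (-1) ^+ n * l.
  rewrite (_ : series g = (fun N => (-1) ^+ n * series f N)).
    exact: cvgMl_tmp.
  by apply/funext => N; rewrite !seriesEnat /= mulr_sumr.
rewrite -(cvg_lim _ gl) //; apply: le_lt_trans (lt_sum_lim_series (n := n) _ _).
- by rewrite /g mulr_sumr /= ?big_mkord.
- by apply/cvg_ex; exists ((-1) ^+ n * l).
- by move=> d; rewrite /g -mulrDr.
Qed.

(** The ratio is x^2 / ((k + 1) (k + 2)) < 4 / 6. For k = 0 it could exceed 1, hence 0 < k here and
    0 < n in [cos_taylor_lt]. *)
Lemma expr_fact_lt x k : 0 < x < 2 -> (0 < k)%N ->
  x ^+ k.+2 / k.+2`!%:R < x ^+ k / k`!%:R.
Proof.
case/andP=> x0 x2 k0; rewrite !factS !natrM.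
have f0 : 0 < k`!%:R :> R by rewrite ltr0n fact_gt0.
have k3 : 3 <= k.+2%:R :> R by rewrite ler_nat.
have k2 : 2 <= k.+1%:R :> R by rewrite ler_nat.
have xk : 0 < x ^+ k by rewrite exprn_gt0.
rewrite !exprS; move: (k`!%:R) (k.+2%:R) (k.+1%:R) (x ^+ k) f0 k3 k2 xk => f a
  b y f0 k3 k2 xk.
have ab0 : 0 < a * (b * f) by rewrite !mulr_gt0 //; lra.
rewrite ltr_pdivrMr // (_ : y / f * (a * (b * f)) = y * (a * b)).
  by rewrite mulrA [_ * y]mulrC ltr_pM2l //; nra.
by field; rewrite gt_eqF.
Qed.

Lemma alternating_pair_gt0 n d (a b : R) : b < a ->
  0 < (-1) ^+ n * ((-1) ^+ (n + d.*2) * a + (-1) ^+ (n + d.*2.+1) * b).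
Proof.
rewrite addnS exprS exprD -[d.*2]muln2 mulnC exprM sqrrN expr1n expr1n mulr1.
have := sqrr_sign R n; rewrite expr2; move: (_ ^+ n) => s ss ba.
suff -> : s * (s * a + -1 * s * b) = a - b by rewrite subr_gt0.
transitivity (s * s * (a - b)); first by ring.
by rewrite ss mul1r.
Qed.

Lemma cos_taylor_lt n x : (0 < n)%N -> 0 < x < 2 ->
  (-1) ^+ n * \sum_(i < n) cos_coeff' x i < (-1) ^+ n * cos x.
Proof.
move=> n0 x02; apply: alternating_sum_lt; first exact: cvg_cos_coeff'.
move=> d; rewrite /cos_coeff' -!exprnP -!mulrA; apply: alternating_pair_gt0.
by rewrite addnS doubleS expr_fact_lt // double_gt0 addn_gt0 n0.
Qed.

Lemma sin_taylor_lt n x : 0 < x < 2 ->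
  (-1) ^+ n * \sum_(i < n) sin_coeff' x i < (-1) ^+ n * sin x.
Proof.
move=> x02; apply: alternating_sum_lt; first exact: cvg_sin_coeff'.
move=> d; rewrite /sin_coeff' -!exprnP -!mulrA; apply: alternating_pair_gt0.
by rewrite addnS doubleS expr_fact_lt.
Qed.

(** This is sin x < x <= tan x squared: the second inequality bounds the cotangent by 1 / x, and 1 /
    sin^2 = cot^2 + 1. *)
Lemma inv_sin_sqr_bounds x : 0 < x < pi / 2 ->
  (x ^+ 2)^-1 <= (sin x ^+ 2)^-1 <= (x ^+ 2)^-1 + 1.
Proof.
move=> /andP[x0 xp]; have x2 : 0 < x < 2 by rewrite x0 (lt_trans xp) ?pihalf_lt2.
have s0 : 0 < sin x by apply: sin_gt0_pihalf; rewrite x0.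
have c0 : 0 < cos x by apply: cos_gt0_pihalf; rewrite xp andbT (lt_trans _ x0)
  // oppr_lt0 divr_gt0 // pi_gt0.
have a0 : sin_coeff' x 0 = x by rewrite /sin_coeff' -exprnP expr0 mul1r divr1.
have a1 : sin_coeff' x 1 = - (x ^+ 3 / 6).
  by rewrite /sin_coeff' -exprnP expr1 mulN1r mulNr.
have b0 : cos_coeff' x 0 = 1 by rewrite /cos_coeff' -exprnP !expr0 mul1r divr1.
have b1 : cos_coeff' x 1 = - (x ^+ 2 / 2).
  by rewrite /cos_coeff' -exprnP expr1 mulN1r mulNr.
have b2 : cos_coeff' x 2 = x ^+ 4 / 24.
  by rewrite /cos_coeff' -exprnP sqrrN expr1n mul1r.
have sx : sin x < x.
  by have := sin_taylor_lt 1 x2; rewrite big_ord_recr big_ord0 /= a0 expr1; lra.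
have xc : x * cos x <= sin x.
  have := sin_taylor_lt 2 x2; rewrite !big_ord_recr big_ord0 /= a0 a1.
  have := @cos_taylor_lt 3 _ isT x2; rewrite !big_ord_recr big_ord0 /= b0 b1 b2.
  rewrite sqrrN expr1n !mul1r add0r exprS sqrrN expr1n mulr1 !mulN1r ltrN2 => c1 s1.
  have c2 := ler_wpM2l (ltW x0) (ltW c1).
  have x3 : 0 < x ^+ 3 by rewrite exprn_gt0.
  have x5 : x ^+ 5 <= 4 * x ^+ 3.
    rewrite (exprD x 2 3) ler_pM2r // expr2.
    by case/andP: x2 => _ x2; nra.
  have E : x * (1 - x ^+ 2 / 2 + x ^+ 4 / 24) = x - x ^+ 3 / 2 + x ^+ 5 / 24 by
    ring.
  rewrite E in c2.
  move: (x ^+ 3) (x ^+ 5) c2 s1 x3 x5 => u v c2 s1 x3 x5; lra.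
apply/andP; split.
  by rewrite lef_pV2 ?posrE ?exprn_gt0 // ler_sqr ?nnegrE ltW.
have -> : (sin x ^+ 2)^-1 = (cos x / sin x) ^+ 2 + 1.
  rewrite exprMn exprVn cos2sin2 mulrBl mul1r divff ?expf_neq0 ?gt_eqF //.
  by rewrite subrK.
have cs0 : 0 <= cos x / sin x by rewrite divr_ge0 // ltW.
have xi0 : 0 <= x^-1 by rewrite invr_ge0 ltW.
rewrite lerD2r -exprVn ler_sqr ?nnegrE //.
by rewrite ler_pdivrMr // mulrC ler_pdivlMr // mulrC.
Qed.

Lemma sum_double_rev (f : nat -> R) N :
  \sum_(k < N + N) f k = \sum_(k < N) (f k + f (N + N - k.+1)%N).
Proof.
rewrite big_split_ord /= [RHS]big_split /=; congr (_ + _).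
rewrite (reindex_inj rev_ord_inj) /=; apply: eq_bigr => k _; congr f.
by have := ltn_ord k; lia.
Qed.

(** Odd multiples of pi / 2^(n + 2) in the first quadrant. At level n + 1 the indices k and 2^(n +
    1) - 1 - k give complementary angles, and twice the first is the angle of index k at level n. *)
Let angle n k : R := k.*2.+1%:R * pi / 2 ^+ n.+2.

Let angle_bounds n k : (k < 2 ^ n)%N -> 0 < angle n k < pi / 2.
Proof.
move=> kn; have p0 := @pi_gt0 R; rewrite /angle; apply/andP; split.
  by rewrite !mulr_gt0 ?invr_gt0 ?exprn_gt0.
rewrite ltr_pdivrMr ?exprn_gt0 // mulrC -mulrA ltr_pM2l // exprS mulrA mulVf //
  mul1r.
by rewrite -natrX ltr_nat expnS; lia.
Qed.

(* Each doubling step uses 1 / sin^2 y + 1 / cos^2 y = 4 / sin^2 (2 y). *)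
Lemma sum_inv_sin_sqr n :
  \sum_(k < 2 ^ n) (sin (angle n k) ^+ 2)^-1 = 2 * 4 ^+ n.
Proof.
elim: n => [|n IHn].
  rewrite big_ord_recr big_ord0 /= add0r expr0 mulr1 /angle mul1r.
  have y2 : pi / 2 ^+ 2 *+ 2 = pi / 2 :> R by rewrite -mulr_natr; field.
  have := cos_mulr2n (pi / 2 ^+ 2 : R); rewrite y2 cos_pihalf sin2cos2.
  move: (cos _ ^+ 2) => c; rewrite -mulr_natr => c2.
  have -> : 1 - c = 2^-1 by lra.
  by rewrite invrK.
rewrite expnS mul2n -addnn (sum_double_rev (fun k => (sin (angle n.+1 k) ^+
  2)^-1)) exprS mulrCA -IHn mulr_sumr.
apply: eq_bigr => k _.
have y2 : angle n k = angle n.+1 k *+ 2.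
  rewrite /angle -mulr_natr [in RHS]exprS; field; exact: expf_neq0.
have yc : angle n.+1 (2 ^ n + 2 ^ n - k.+1) = pi / 2 - angle n.+1 k.
  have E : ((2 ^ n + 2 ^ n - k.+1).*2.+1 + k.*2.+1 = 4 * 2 ^ n)%N.
    by have := ltn_ord k; lia.
  have {}E := congr1 (fun i => i%:R : R) E; rewrite natrD natrM natrX in E.
  have -> : angle n.+1 (2 ^ n + 2 ^ n - k.+1) = (4 * 2 ^+ n - k.*2.+1%:R) * pi
    / 2 ^+ n.+3.
    by rewrite -E addrK.
  have z0 : 2 ^+ n != 0 :> R by rewrite expf_neq0.
  by rewrite /angle !exprS; move: (2 ^+ n) z0 => z z0; field.
have [kn kp] := andP (angle_bounds (ltn_ord k)).
rewrite yc y2 sinB sin_pihalf cos_pihalf mul0r subr0 mul1r sin_mulr2n.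
have yp : 0 < angle n.+1 k < pi / 2.
  by apply: angle_bounds; rewrite expnS mul2n -addnn (leq_trans (ltn_ord k)) //
    leq_addr.
have s0 : 0 < sin (angle n.+1 k) by apply: sin_gt0_pihalf.
have c0 : 0 < cos (angle n.+1 k).
  by case/andP: yp => y0 yp; apply: cos_gt0_pihalf;
    rewrite yp andbT (lt_trans _ y0) // oppr_lt0 divr_gt0 // pi_gt0.
have := cos2Dsin2 (angle n.+1 k).
move: (sin _) (cos _) s0 c0 => s c s0 c0 sc.
transitivity ((c ^+ 2 + s ^+ 2) / (c ^+ 2 * s ^+ 2)).
  by field; rewrite !gt_eqF.
by rewrite sc -mulr_natr; field; rewrite !gt_eqF.
Qed.

(** The excess 1 in the bound on 1 / sin^2, over 2^n angles, adds 2^n to a total of 2 * 4^n;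
    rescaled by pi^2 / (16 * 4^n) it becomes the error term on the left. *)
Lemma sum_odd_inv_sqr_bounds n :
  pi ^+ 2 / 8 - pi ^+ 2 / 16 / 2 ^+ n <=
    \sum_(k < 2 ^ n) ((k.*2.+1%:R : R) ^+ 2)^-1 <= pi ^+ 2 / 8.
Proof.
have p0 := @pi_gt0 R.
have n4 : 4 ^+ n = 2 ^+ n * 2 ^+ n :> R by rewrite -exprMn -natrM.
have E : \sum_(k < 2 ^ n) (angle n k ^+ 2)^-1 =
   16 * 4 ^+ n / pi ^+ 2 * \sum_(k < 2 ^ n) ((k.*2.+1%:R : R) ^+ 2)^-1.
  rewrite mulr_sumr; apply: eq_bigr => k _; rewrite /angle.
  have -> : 16 * 4 ^+ n = (2 ^+ n.+2) ^+ 2 :> R.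
    by rewrite n4 !exprS expr0; ring.
  have k0 : k.*2.+1%:R != 0 :> R by rewrite pnatr_eq0.
  have z0 : 2 ^+ n.+2 != 0 :> R by rewrite expf_neq0.
  have pi0 : pi != 0 :> R by rewrite gt_eqF.
  by move: (_%:R) (2 ^+ _) (pi : R) k0 z0 pi0 => a b c a0 b0 c0; field;
    rewrite a0 b0 c0.
have S1 : \sum_(k < 2 ^ n) (angle n k ^+ 2)^-1 <= 2 * 4 ^+ n.
  rewrite -sum_inv_sin_sqr; apply: ler_sum => k _.
  by have /inv_sin_sqr_bounds/andP[] := angle_bounds (ltn_ord k).
have S2 : 2 * 4 ^+ n <= \sum_(k < 2 ^ n) (angle n k ^+ 2)^-1 + 2 ^+ n.
  rewrite -sum_inv_sin_sqr -natrX -[X in X%:R]card_ord -sumr_const -big_split.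
  apply: ler_sum => k _.
  by have /inv_sin_sqr_bounds/andP[] := angle_bounds (ltn_ord k).
have n2 : 0 < 2 ^+ n :> R by rewrite exprn_gt0.
move: S1 S2; rewrite E n4; move: (bigop _ _ _) (2 ^+ n) n2 => s z z0 S1 S2.
have pp : 0 < pi ^+ 2 :> R by rewrite exprn_gt0.
move: (pi ^+ 2) pp S1 S2 => t t0 S1 S2.
have zz : 0 < z * z by rewrite mulr_gt0.
have w0 : 0 <= t / (16 * (z * z)) by rewrite divr_ge0 ?mulr_ge0 // ltW.
apply/andP; split; rewrite -subr_ge0.
  have -> : s - (t / 8 - t / 16 / z) =
      t / (16 * (z * z)) * (16 * (z * z) / t * s + z - 2 * (z * z)).
    by field; rewrite !gt_eqF.
  by rewrite mulr_ge0 // subr_ge0.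
have -> : t / 8 - s = t / (16 * (z * z)) * (2 * (z * z) - 16 * (z * z) / t * s).
  by field; rewrite !gt_eqF.
by rewrite mulr_ge0 // subr_ge0.
Qed.

Definition sum_inv_sqr N : R := \sum_(1 <= e < N.+1) (e%:R ^+ 2)^-1.

Lemma sum_inv_sqrS N : sum_inv_sqr N.+1 = sum_inv_sqr N + (N.+1%:R ^+ 2)^-1.
Proof. by rewrite /sum_inv_sqr big_nat_recr. Qed.

Lemma sum_inv_sqr_double N :
  sum_inv_sqr N.*2 = \sum_(k < N) ((k.*2.+1%:R : R) ^+ 2)^-1 + sum_inv_sqr N / 4.
Proof.
elim: N => [|N IHN]; first by rewrite /sum_inv_sqr !big_geq // big_ord0 mul0r addr0.
rewrite doubleS !sum_inv_sqrS IHN big_ord_recr /= [(_ + _) / 4]mulrDl.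
rewrite -!addrA; congr (_ + _); rewrite addrCA; congr (_ + (_ + _)).
by rewrite -doubleS -muln2 natrM exprMn invfM [2 ^+ 2]expr2 -natrM.
Qed.

(** For M = 2^N, S(M) <= S(2 M) and the splitting of S(2 M) into odd and even terms bound 3 / 4 of
    S(M) by the odd sum, which is at most pi^2 / 8. *)
Lemma sum_inv_sqr_le_pi N : sum_inv_sqr N <= pi ^+ 2 / 6.
Proof.
have mono a b : (a <= b)%N -> sum_inv_sqr a <= sum_inv_sqr b.
  move=> ab; rewrite /sum_inv_sqr [leRHS](@big_cat_nat _ _ _ a.+1) //= lerDl.
  by apply: sumr_ge0 => e _; rewrite invr_ge0 exprn_ge0.
have N2 : (N <= 2 ^ N)%N by rewrite ltnW // ltn_expl.
apply: le_trans (mono _ _ N2) _.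
have : (2 ^ N <= (2 ^ N).*2)%N by rewrite -addnn leq_addr.
move=> /mono; rewrite sum_inv_sqr_double.
have /andP[_] := sum_odd_inv_sqr_bounds N.
by move: (bigop _ _ _) (pi ^+ 2) (sum_inv_sqr _) => a b c; lra.
Qed.

Lemma pi_le_sum_inv_sqr N : (0 < N)%N -> pi ^+ 2 / 6 <= sum_inv_sqr N + N%:R^-1.
Proof.
move=> N0; set U := _ + _.
have HU M : (N <= M)%N -> sum_inv_sqr M <= U.
  move=> NM; rewrite /sum_inv_sqr (@big_cat_nat _ _ _ N.+1) //= lerD2l.
  apply: le_trans (sum_inv_sqr_tail_le _ _) _; first by rewrite N0.
  by rewrite gerBl invr_ge0.
(* With e = 2^-n, the bound S(2^(n + 1)) <= S(2^n) + e and the splitting give 3 / 4 S(2^(n + 1)) >=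
   pi^2 / 8 - (pi^2 / 16 + 1 / 4) e, whence [C]. *)
pose C := (pi ^+ 2 / 16 + 1 / 4) * 4 / 3 : R.
have : (fun n => pi ^+ 2 / 6 - C * 2^-1 ^+ n) @ \oo --> pi ^+ 2 / 6.
  rewrite -[X in _ --> X]subr0; apply: cvgB; first exact: cvg_cst.
  apply: cvg_geometric; rewrite ger0_norm; lra.
move=> /cvgr_to_le; apply.
near=> n.
have nN : (N <= 2 ^ n)%N by rewrite (leq_trans _ (ltnW (ltn_expl n _))) //;
  near: n; exact: nbhs_infty_ge.
have n2 : (2 ^ n <= (2 ^ n).*2)%N by rewrite -addnn leq_addr.
have h1 := HU _ (leq_trans nN n2).
have /andP[h2 _] := sum_odd_inv_sqr_bounds n.
have h3 : sum_inv_sqr (2 ^ n).*2 <= sum_inv_sqr (2 ^ n) + (2 ^+ n)^-1.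
  rewrite /sum_inv_sqr (@big_cat_nat _ _ _ (2 ^ n).+1) //= lerD2l.
  apply: le_trans (sum_inv_sqr_tail_le _ _) _; first by rewrite expn_gt0.
  by rewrite -natrX gerBl invr_ge0.
have h4 := sum_inv_sqr_double (2 ^ n).
rewrite exprVn /C.
move: h1 h2 h3 h4; move: (sum_inv_sqr _) (sum_inv_sqr _) (bigop _ _ _) (pi ^+
  2) ((2 ^+ n)^-1) => a b c d e.
nra.
Unshelve. all: end_near.
Qed.

Lemma cos_coeff'0 x : cos_coeff' x 0 = 1.
Proof. by rewrite /cos_coeff' -exprnP !expr0 mul1r divr1. Qed.

Lemma cos_coeff'S x k :
  cos_coeff' x k.+1 = - (cos_coeff' x k * x ^+ 2 / (k.*2.+2 * k.*2.+1)%:R).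
Proof.
rewrite /cos_coeff' -!exprnP doubleS (factS k.*2.+1) (factS k.*2) mulnA.
by rewrite [in LHS]natrM [in LHS]invfM !exprS expr0; ring.
Qed.

End TrigonometricBounds.

(* Both fractions come from the continued fraction of pi, where the mediant
   7433 / 2366 = (20 * 355 + 333) / (20 * 113 + 106) is the one below pi. *)
Lemma pi_rational_bounds (R : realType) : 7433 / 2366 < (pi : R) < 355 / 113.
Proof.
have p2 := @pi_ge2 R.
have ltcos (a b : R) : 0 <= a <= pi -> 0 <= b <= pi -> (cos a < cos b) = (b < a).
  by move=> ha hb; rewrite ltr_cos ?in_itv.
have ph : 0 <= (pi / 2 : R) <= pi by apply/andP; split; lra.
have in_range (a : R) : 0 < a < 2 -> 0 <= a <= pi.
  by case/andP=> a0 a2; rewrite ltW //= (le_trans (ltW a2)).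
have lt_pihalf (x : R) : 0 < x < 2 -> (cos x < 0) = (pi / 2 < x) /\ (0 < cos x)
  = (x < pi / 2).
  by move=> /in_range x02; rewrite -cos_pihalf !ltcos.
apply/andP; split.
  have [x xE] : exists x : R, x = 7433 / 4732 by eexists.
  have x02 : 0 < x < 2 by move: xE; clear; move=> xE; apply/andP; split; lra.
  suff : x < pi / 2 by move: xE; clear; lra.
  rewrite -(lt_pihalf x x02).2.
  (* An even number of terms bounds the cosine from below, an odd number from above; six and seven
     terms decide its sign at half of each fraction. *)
  have := @cos_taylor_lt R 6 x isT x02.
  rewrite (exprM _ 2 3) sqrrN !expr1n !mul1r.
  apply: le_lt_trans; rewrite !big_ord_recr big_ord0 /= !cos_coeff'S cos_coeff'0.
  rewrite /muln /= /muln_rec /=.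
  by move: xE; clear => ->; lra.
have [x xE] : exists x : R, x = 355 / 226 by eexists.
have x02 : 0 < x < 2 by move: xE; clear; move=> xE; apply/andP; split; lra.
suff : pi / 2 < x by move: xE; clear; lra.
rewrite -(lt_pihalf x x02).1.
have := @cos_taylor_lt R 7 x isT x02.
rewrite exprS (exprM _ 2 3) sqrrN !expr1n !mulr1 !mulN1r ltrN2 => /lt_le_trans;
  apply.
rewrite !big_ord_recr big_ord0 /= !cos_coeff'S cos_coeff'0.
rewrite /muln /= /muln_rec /=.
by move: xE; clear => ->; lra.
Qed.

(** As 2 y / (y - 4) = 2 + 8 / (y - 4) decreases in y = pi^2, the upper bound on pi gives the lower
    decimal and conversely. *)
Lemma measure_bound_decimals (R : realType) :
  336 / 10 ^+ 2 + 295 / 10 ^+ 5 <= 2 * (pi : R) ^+ 2 / (pi ^+ 2 - 4)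
    < 336 / 10 ^+ 2 + 296 / 10 ^+ 5.
Proof.
have /andP[h1 h2] := pi_rational_bounds R.
have sqr_lt (a b : R) : 0 <= a -> a < b -> a ^+ 2 < b ^+ 2.
  by move=> a0 ab; rewrite ltr_sqr // nnegrE (le_trans a0) // ltW.
have lo0 : 0 <= 7433 / 2366 :> R by clear; lra.
move: (sqr_lt _ _ lo0 h1) (sqr_lt _ _ (pi_ge0 R) h2).
move: (pi ^+ 2) => y; clear => k1 k2.
have y4 : 0 < y - 4 by lra.
apply/andP; split; [rewrite ler_pdivlMr //; lra|rewrite ltr_pdivrMr //; lra].
Qed.

(** * Irrationality measure from quadratic-exponential rates *)

Section IrrationalityCriterion.
Variable R : realType.

(** This says u n = c n^2 + o(n^2). The term C n takes up linear errors directly and, as n > 0, any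
    finite set of exceptions. *)
Definition quadratic_growth (u : R^nat) (c : R) :=
  forall eps, 0 < eps -> exists C, forall n, (0 < n)%N ->
    `|u n - c * n%:R ^+ 2| <= eps * n%:R ^+ 2 + C * n%:R.

Lemma quadratic_growth_near (u : R^nat) (c : R) : quadratic_growth u c ->
  forall eps, 0 < eps -> exists2 N, (0 < N)%N & forall n, (N <= n)%N ->
    `|u n - c * n%:R ^+ 2| <= eps * n%:R ^+ 2.
Proof.
move=> uc eps e0; have [C HC] := uc _ (divr_gt0 e0 (ltr0Sn _ 1)).
pose x := `|C| / (eps / 2).
have x0 : 0 <= x by rewrite divr_ge0 // divr_ge0 // ltW.
exists (Num.bound x).+1 => // n Nn.
have n0 : (0 < n)%N by apply: leq_ltn_trans Nn.
apply: le_trans (HC n n0) _.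
have xn : x <= n%:R.
  by apply: le_trans (ltW (archi_boundP x0)) _; rewrite ler_nat ltnW.
have : C <= eps / 2 * n%:R.
  by rewrite mulrC -ler_pdivrMr ?divr_gt0 // (le_trans _ xn) // ler_pM2r
    ?invr_gt0 ?divr_gt0 // ler_norm.
have : 0 < n%:R :> R by rewrite ltr0n.
move: (n%:R) => y y0 Cy; have := ler_wpM2r (ltW y0) Cy; rewrite expr2; lra.
Qed.

Lemma quadratic_growth_bounded_diff (u v : R^nat) (c : R) :
  quadratic_growth u c ->
  (exists K, forall n, (0 < n)%N -> `|v n - u n| <= K * n%:R) ->
  quadratic_growth v c.
Proof.
move=> uc [K HK] eps e0; have [C HC] := uc _ e0; exists (C + K) => n n0.
have -> : v n - c * n%:R ^+ 2 = (u n - c * n%:R ^+ 2) + (v n - u n) by ring.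
apply: le_trans (ler_normD _ _) _; apply: le_trans (lerD (HC n n0) (HK n n0)) _.
by rewrite mulrDl addrA.
Qed.

Lemma quadratic_growthN (u : R^nat) c :
  quadratic_growth u c -> quadratic_growth (fun n => - u n) (- c).
Proof.
move=> uc eps e0; have [C HC] := uc _ e0; exists C => n n0.
by rewrite mulNr -opprD normrN HC.
Qed.

Lemma quadratic_growthD (u v : R^nat) c c' :
  quadratic_growth u c -> quadratic_growth v c' ->
  quadratic_growth (fun n => u n + v n) (c + c').
Proof.
move=> uc vc eps e0; have e2 : 0 < eps / 2 by rewrite divr_gt0.
have [C HC] := uc _ e2; have [D HD] := vc _ e2; exists (C + D) => n n0.
have -> : u n + v n - (c + c') * n%:R ^+ 2 =
  (u n - c * n%:R ^+ 2) + (v n - c' * n%:R ^+ 2) by ring.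
apply: le_trans (ler_normD _ _) _; apply: le_trans (lerD (HC n n0) (HD n n0)) _.
lra.
Qed.

Lemma quadratic_growthB (u v : R^nat) c c' :
  quadratic_growth u c -> quadratic_growth v c' ->
  quadratic_growth (fun n => u n - v n) (c - c').
Proof. by move=> uc vc; apply: quadratic_growthD uc (quadratic_growthN vc). Qed.

Lemma quadratic_growth_cvg (u : R^nat) (c : R) : quadratic_growth u c ->
  (fun n => u n / n%:R ^+ 2) @ \oo --> c.
Proof.
move=> uc; apply/cvgrPdist_le => e e0.
have [N N0 HN] := quadratic_growth_near uc e0.
exists N => // n /= Nn; have n0 : 0 < n%:R :> R by rewrite ltr0n (leq_trans N0).
have n2 : 0 < n%:R ^+ 2 :> R by rewrite exprn_gt0.
rewrite distrC -(ler_pM2r n2) -[X in _ * X]gtr0_norm // -normrM mulrBl divfK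
  ?gt_eqF //.
exact: HN.
Qed.

(** For s > 1 the lower-order part 2 K s + K + L is at most (3 K + L) s. When D > K this bounds
    s. *)
Let quadratic_bound (D K L s : R) : 0 <= K -> 0 <= L -> 1 < s ->
  D * s ^+ 2 - L <= K * (s + 1) ^+ 2 -> s * (D - K) <= 3 * K + L.
Proof.
move=> K0 L0 s1 H; have s0 : 0 < s by apply: lt_trans s1.
rewrite -(ler_pM2l s0).
have sK : 0 <= K * (s - 1) by rewrite mulr_ge0 // subr_ge0 ltW.
have sL : 0 <= L * (s - 1) by rewrite mulr_ge0 // subr_ge0 ltW.
move: H; rewrite !expr2; lra.
Qed.

Variables (alpha : R) (a b : nat -> int) (A B : R).
Let e n : R := (b n)%:~R * alpha - (a n)%:~R.
Hypothesis A_gt0 : 0 < A.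
Hypothesis B_gt0 : 0 < B.
Hypothesis b_gt0 : forall n, (0 < n)%N -> 0 < b n.
Hypothesis e_neq0 : forall n, (0 < n)%N -> e n != 0.
Hypothesis growth_b : quadratic_growth (fun n => ln (b n)%:~R) B.
Hypothesis growth_e : quadratic_growth (fun n => ln `|e n|) (- A).

(** If alpha had denominator d, every nonzero e n would be at least 1 / d in absolute value, whereas
    ln |e n| tends to - infinity. *)
Lemma irrational_criterion : irrational alpha.
Proof.
have A0 := A_gt0; move=> /= [q _ aq].
have [N N0 HN] := quadratic_growth_near growth_e (divr_gt0 A_gt0 (ltr0Sn _ 1)).
pose d : R := (denq q)%:~R.
have d1 : 1 <= d by rewrite ler1z; have := denq_gt0 q.
have d0 : 0 < d by apply: lt_le_trans d1.
have low n : (0 < n)%N -> - ln d <= ln `|e n|.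
  move=> n0; have en0 : 0 < `|e n| by rewrite normr_gt0 e_neq0.
  rewrite -lnV ?posrE // ler_ln ?posrE ?invr_gt0 //.
  rewrite -[leLHS]div1r ler_pdivrMr // -[d]gtr0_norm // -normrM.
  have E : e n * d = (b n * numq q - a n * denq q)%:~R.
    rewrite rmorphB !rmorphM /= -/d /e mulrBl -aq /ratr -/d.
    by rewrite -mulrA -[X in _ * X]mulrA mulVf ?mulr1 // gt_eqF.
  have : e n * d != 0 by rewrite mulf_neq0 ?e_neq0 // gt_eqF.
  by rewrite E => z0; apply: norm_intr_ge1; rewrite ?intr_int.
pose x := ln d / (A / 2).
have x0 : 0 <= x by rewrite divr_ge0 ?ln_ge0 // divr_ge0 // ltW.
pose n := (N + Num.bound x)%N.
have n0 : (0 < n)%N by rewrite addn_gt0 N0.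
have := HN n (leq_addr _ _); rewrite ler_norml => /andP[_].
have := low n n0.
have : ln d < A / 2 * n%:R.
  rewrite mulrC -ltr_pdivrMr ?divr_gt0 // (lt_le_trans (archi_boundP x0)) //
    ler_nat.
  by rewrite leq_addl.
have : A / 2 * n%:R <= A / 2 * n%:R ^+ 2.
  by rewrite ler_pM2l ?divr_gt0 // -natrX ler_nat -{1}[n]expn1 leq_pexp2l.
move: (n%:R : R) (ln d) (ln `|e n|) => y u v; lra.
Qed.

(* If x / y is not the convergent a n / b n, then |x (b n) - y (a n)| >= 1. *)
Let approximation_lower_bound n (x y : int) : (0 < n)%N -> 1 <= y ->
  `|e n| <= (2 * y%:~R)^-1 ->
  `|e n| / (b n)%:~R <= `|alpha - x%:~R / y%:~R|.
Proof.
move=> n0 y1 en2.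
have bn0 : 0 < (b n)%:~R :> R by rewrite ltr0z b_gt0.
have y0 : 0 < y%:~R :> R by rewrite ltr0z; apply: lt_le_trans y1.
have [xb|xb] := eqVneq (x * b n) (y * a n).
  rewrite (_ : alpha - x%:~R / y%:~R = e n / (b n)%:~R).
    by rewrite normrM normfV (gtr0_norm bn0).
  rewrite /e mulrBl [_ * alpha]mulrC mulfK ?gt_eqF //; congr (_ - _).
  by apply/eqP; rewrite eqr_div ?lt0r_neq0 // -!intrM eqr_int xb mulrC.
have xb1 : 1 <= `|x%:~R * (b n)%:~R - y%:~R * (a n)%:~R| :> R.
  rewrite -!rmorphM -rmorphB; apply: norm_intr_ge1; rewrite ?intr_int //.
  by rewrite intr_eq0 subr_eq0.
have y20 : 0 < 2 * y%:~R :> R by rewrite mulr_gt0.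
apply: le_trans (_ : (2 * y%:~R)^-1 / (b n)%:~R <= _).
  by rewrite ler_pM2r ?invr_gt0.
rewrite ler_pdivrMr // -[leLHS]div1r ler_pdivrMr //.
have E : x%:~R * (b n)%:~R - y%:~R * (a n)%:~R =
    y%:~R * e n - (b n)%:~R * y%:~R * (alpha - x%:~R / y%:~R).
  by rewrite /e; field; rewrite gt_eqF.
have h1 : `|y%:~R * e n| <= 1 / 2.
  rewrite normrM (gtr0_norm y0) mulrC -ler_pdivlMr //.
  by apply: le_trans en2 _; rewrite invfM div1r.
have h2 : `|(b n)%:~R * y%:~R * (alpha - x%:~R / y%:~R)| =
    (b n)%:~R * y%:~R * `|alpha - x%:~R / y%:~R|.
  by rewrite normrM gtr0_norm // mulr_gt0.
rewrite {}E in xb1; have := le_trans xb1 (ler_normB _ _); rewrite h2.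
by move: (`|_ * e n|) h1 => u; lra.
Qed.

Let finite_approximations (r : R) : 1 + B / A < r ->
  exists2 M : R, 0 <= M & forall x y : int, 1 <= y ->
    `|alpha - x%:~R / y%:~R| < ((y%:~R : R) `^ r)^-1 -> (y%:~R : R) <= M.
Proof.
have A0 := A_gt0; have B0 := B_gt0; move=> rAB.
have r0 : 0 < r by apply: lt_trans rAB; rewrite addr_gt0 // divr_gt0.
pose d := r * A - A - B.
have d0 : 0 < d.
  have := rAB; rewrite -(ltr_pM2r A_gt0) mulrDl divfK ?gt_eqF // mul1r /d; lra.
(* Chosen so that r A1 - K = d - eps (r + 2) = d / 2 stays positive. *)
pose eps := d / (2 * (r + 2)).
have r2 : 0 < 2 * (r + 2) by lra.
have eps0 : 0 < eps by rewrite divr_gt0.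
have epsE : eps * (2 * (r + 2)) = d by rewrite divfK // gt_eqF.
have epsA : eps < A.
  by rewrite /eps ltr_pdivrMr // /d; have := mulr_gt0 r0 A_gt0; lra.
pose A1 := A - eps; pose K := A + B + 2 * eps.
have A10 : 0 < A1 by rewrite /A1; lra.
have K0 : 0 < K by rewrite /K; lra.
have rK : 0 < r * A1 - K by rewrite /A1 /K; rewrite /d in epsE; nra.
have [N1 _ HN1] := quadratic_growth_near growth_b eps0.
have [N2 N20 HN2] := quadratic_growth_near growth_e eps0.
pose l2 : R := ln 2.
pose S0 := (3 * K + r * l2) / (r * A1 - K).
(* The three entries cover s <= 1, an index n below the thresholds of the growth estimates, and the
   main case. *)
pose S := Num.max 1 (Num.max (maxn N1 N2)%:R S0).
exists (expR (A1 * S ^+ 2)); first exact: expR_ge0.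
move=> x y y1 xy.
have y1R : 1 <= y%:~R :> R by rewrite ler1z.
have y0 : 0 < y%:~R :> R by apply: lt_le_trans y1R.
pose X : R := ln (2 * y%:~R).
have X0 : 0 <= X by apply: ln_ge0; lra.
(* The real index at which the upper estimate exp(- A1 s^2) of |e n| equals 1 / (2 y). The least
   integer n > s gives the approximation to be compared with x / y. *)
pose s := Num.sqrt (X / A1).
have s0 : 0 <= s by exact: sqrtr_ge0.
have sE : A1 * s ^+ 2 = X by rewrite sqr_sqrtr ?divr_ge0 ?(ltW A10) // mulrC
  divfK // gt_eqF.
have lny : ln y%:~R = X - l2 by rewrite /X lnM ?posrE // addrAC subrr add0r.
have sS : s <= S.
  rewrite /S !le_max; case: (leP s 1) => //= s1.
  case: (leP s _) => //= sN.
  pose n := (Num.trunc s).+1.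
  have [ns sn] : n%:R <= s + 1 /\ s < n%:R.
    have := truncn_itv s0; rewrite /n -natr1 => /andP[h1 h2]; split => //.
    by rewrite lerD2r.
  have n0 : (0 < n)%N by [].
  have nN : (maxn N1 N2 <= n)%N by rewrite -(ler_nat R) ltW // (lt_trans sN).
  have main : r * ln y%:~R <= K * n%:R ^+ 2.
    have := HN1 n (leq_trans (leq_maxl _ _) nN); rewrite ler_norml => /andP[_ b1].
    have := HN2 n (leq_trans (leq_maxr _ _) nN); rewrite ler_norml => /andP[e2 e1].
    have en0 : 0 < `|e n| by rewrite normr_gt0 e_neq0.
    have bn0 : 0 < (b n)%:~R :> R by rewrite ltr0z b_gt0.
    have Xn : X <= A1 * n%:R ^+ 2.
      by rewrite -sE ler_pM2l // ler_sqr ?nnegrE // ltW.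
    have en2 : `|e n| <= (2 * y%:~R)^-1.
      have y2 : 0 < 2 * y%:~R :> R by lra.
      rewrite -ler_ln ?posrE ?invr_gt0 // lnV ?posrE // -/X.
      rewrite (le_trans (_ : _ <= - (A1 * n%:R ^+ 2))) ?lerN2 //.
      move: e1; rewrite /A1; lra.
    have low := @approximation_lower_bound n x y n0 y1 en2.
    have elb : `|e n| / (b n)%:~R = expR (ln `|e n| - ln (b n)%:~R).
      by rewrite expRD expRN !lnK.
    have := le_lt_trans low xy; rewrite elb /powR gt_eqF // -expRN ltr_expR.
    rewrite ltrNr => /ltW; move/le_trans; apply.
    rewrite /K; move: b1 e2; lra.
  rewrite /S0 ler_pdivlMr //.
  have sn2 : n%:R ^+ 2 <= (s + 1) ^+ 2 by rewrite ler_sqr ?nnegrE ?addr_ge0.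
  have l20 : 0 <= r * l2 by rewrite mulr_ge0 ?(ltW r0) // ln_ge0 // ler1n.
  apply: quadratic_bound => //; first exact: ltW.
  apply: le_trans (ler_wpM2l (ltW K0) sn2); apply: le_trans main.
  by rewrite -[r * A1 * _]mulrA sE -mulrBr -lny.
rewrite -(lnK y0) ler_expR lny.
have : A1 * s ^+ 2 <= A1 * S ^+ 2.
  by rewrite ler_pM2l // ler_sqr ?nnegrE // (le_trans s0).
have : 0 <= l2 by apply: ln_ge0; lra.
rewrite sE; lra.
Qed.

Let finite_int_ball (m : nat) : finite_set [set x : int | (`|x| <= m)%N].
Proof.
apply: (@sub_finite_set _ _ ((fun k : nat => k%:Z - m%:Z) @` `I_(m + m).+1)).
  move=> x /= xm; exists (absz (x + m%:Z)%R); rewrite /=; lia.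
exact/finite_image/finite_II.
Qed.

Let absz_le_nat (z : int) (m : nat) : `|z%:~R : R| <= m%:R -> (`|z| <= m)%N.
Proof. by rewrite -intr_norm (_ : m%:R = (m%:Z)%:~R) // ler_int; lia. Qed.

(** Each exponent 1 + B / A + d admits finitely many pairs: [finite_approximations] bounds y, and
    then |alpha - x / y| <= 1 bounds x. *)
Lemma irrationality_measure_criterion :
  (irrationality_measure alpha <= (1 + B / A)%:E)%E.
Proof.
apply/lee_addgt0Pr => d d0; rewrite -EFinD.
apply: ereal_inf_lbound => /=; exists (1 + B / A + d) => //.
have rAB : 1 + B / A < 1 + B / A + d by rewrite ltrDl.
have [M M0 HM] := finite_approximations rAB.
set r := _ + d in rAB HM *.
have r0 : 0 < r by apply: lt_trans rAB; rewrite addr_gt0 // divr_gt0.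
pose m := Num.bound ((`|alpha| + 1) * M + M).
apply: (@sub_finite_set _ _ ([set x : int | (`|x| <= m)%N] `*` [set x : int |
  (`|x| <= m)%N])); last first.
  exact: finite_setX.
move=> [x y] /= [y1 xy].
have yM := HM _ _ y1 xy.
have y1R : 1 <= y%:~R :> R by rewrite ler1z.
have y0 : 0 < y%:~R :> R by apply: lt_le_trans y1R.
have m0 : (`|alpha| + 1) * M + M < m%:R.
  by apply: archi_boundP; rewrite addr_ge0 // mulr_ge0 // addr_ge0.
have aM : 0 <= (`|alpha| + 1) * M by rewrite mulr_ge0 // addr_ge0.
have small : `|alpha - x%:~R / y%:~R| <= 1.
  apply: le_trans (ltW xy) _; rewrite invf_le1 ?powR_gt0 //.
  apply: le_trans (le1r_powR y1R _) => //.
  by rewrite ltW // (lt_trans _ rAB) // ltrDl divr_gt0.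
have xM : `|x%:~R : R| <= (`|alpha| + 1) * M.
  have : `|x%:~R / y%:~R : R| <= `|alpha| + 1.
    rewrite -[X in `|X|](subKr alpha); apply: le_trans (ler_normB _ _) _.
    by rewrite lerD2l.
  rewrite normrM normfV (gtr0_norm y0) ler_pdivrMr // => /le_trans; apply.
  by rewrite ler_wpM2l // addr_ge0.
move: m m0 => {}m m0.
split; apply: absz_le_nat.
  by apply: le_trans xM _; apply: le_trans (ltW m0); rewrite lerDl.
by rewrite (gtr0_norm y0) (le_trans yM) // (le_trans _ (ltW m0)) // lerDr.
Qed.

End IrrationalityCriterion.

(** * The approximations to ln_p(2) *)

Section Approximations.
Variables (R : realType) (p : nat).
Hypothesis p_gt1 : (1 < p)%N.

Let x : R := p%:R.
Let d n : R := (cyclotomic_prod n (p%:Z ^+ 2))%:~R.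
Let P n : R := (qleg_poly x n).[- x ^+ n].

Let x_gt1 : 1 < x. Proof. by rewrite ltr1n. Qed.
Let x_ge2 : 2 <= x. Proof. by rewrite ler_nat. Qed.
Let x_gt0 : 0 < x. Proof. exact: lt_trans x_gt1. Qed.
Let x_nat : x \is a Num.nat. Proof. exact: natr_nat. Qed.

Let p2_ge2 : 2 <= p%:Z ^+ 2.
Proof. by rewrite expr2; move: p_gt1 => h; nia. Qed.

Let approx_denE n : approx_den R p n = d n * P n.
Proof. by rewrite /approx_den little_qLegendreE. Qed.

Let neg_neq_expr n j : - x ^+ n != x^-1 ^+ j.
Proof. by rewrite lt_eqF // (lt_trans (_ : _ < 0)) ?oppr_lt0 ?exprn_gt0
  ?invr_gt0. Qed.

Let approx_numE n : approx_num R p n =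
  d n * (qint x (diffq_poly (qleg_poly x n) (- x ^+ n))
         - P n * \sum_(1 <= i < n) (x ^+ i + 1)^-1).
Proof.
rewrite /approx_num approx_denE little_qLegendre_assocE //.
by rewrite mulrBr mulrA.
Qed.

Let d_ge1 n : 1 <= d n.
Proof. by rewrite ler1z; exact: cyclotomic_prod_gt0. Qed.

Let P_ge1 n : 1 <= P n.
Proof.
apply: le_trans (horner_qlegN_ge x_gt1 n); apply: exprn_ege1; exact: ltW.
Qed.

Let approx_den_ge1 n : 1 <= approx_den R p n.
Proof. by rewrite approx_denE -[leLHS]mulr1 ler_pM. Qed.

Let qbinom_int n k : qbinom x n k \is a Num.int.
Proof. by apply: intr_nat; exact: qbinom_nat. Qed.

Let x_int : x \is a Num.int. Proof. exact: natr_int. Qed.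

Let approx_den_int n : approx_den R p n \is a Num.int.
Proof.
rewrite approx_denE rpredM ?intr_int // /P horner_qlegN //.
by apply: rpred_sum => k _; rewrite !rpredM ?rpredX.
Qed.

Let approx_den_nat n : approx_den R p n \is a Num.nat.
Proof. by rewrite -intrEge0 ?(le_trans _ (approx_den_ge1 n)). Qed.

Let d_dvd n k : (0 < k <= n)%N ->
  (d n / (x ^+ k - 1) \is a Num.int) * (d n / (x ^+ k + 1) \is a Num.int).
Proof.
move=> kn; have /dvdzP[c E] := dvdz_cyclotomic_prod (p%:Z ^+ 2) kn.
have k0 : (0 < k)%N by case/andP: kn.
have a0 : x ^+ k - 1 != 0 by rewrite gt_eqF // subr_gt0 exprn_egt1 // -lt0n.
have b0 : x ^+ k + 1 != 0 by rewrite gt_eqF // addr_gt0 // exprn_gt0.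
have -> : d n = c%:~R * ((x ^+ k - 1) * (x ^+ k + 1)).
  rewrite /d E rmorphM rmorphB !rmorphXn /= -exprM mulnC exprM; congr (_ * _).
  by rewrite -[(p%:Z)%:~R]/x; ring.
split.
  by rewrite [(x ^+ k - 1) * _]mulrC mulrA mulfK // rpredM ?intr_int // rpredD
    ?rpredX ?rpred1.
by rewrite mulrA mulfK // rpredM ?intr_int // rpredB ?rpredX ?rpred1.
Qed.

Let approx_num_int n : (0 < n)%N -> approx_num R p n \is a Num.int.
Proof.
move=> n0; rewrite approx_numE qint_diffq_qleg //.
(* The part with P n is exactly what [approx_num] subtracts; the values at p^(n - i) remain. *)
have -> : \sum_(1 <= i < n) (P n - (qleg_poly x n).[x ^+ (n - i)]) / (x ^+ i + 1)
    = P n * (\sum_(1 <= i < n) (x ^+ i + 1)^-1) -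
      \sum_(1 <= i < n) (qleg_poly x n).[x ^+ (n - i)] / (x ^+ i + 1).
  by rewrite mulr_sumr -sumrB; apply: eq_bigr => i _; rewrite mulrBl.
rewrite addrA addrAC addrK mulrBr rpredB //.
  rewrite mulr_sumr rpred_sum // => k _; rewrite mulrCA mulr_sumr !rpredM
    ?rpredX //.
  apply: rpred_sum => s _; rewrite mulrCA rpredM ?rpredX ?rpredN ?rpred1 //.
  by rewrite d_dvd //= (leq_trans (ltn_ord s)) // -ltnS.
rewrite mulr_sumr big_seq rpred_sum // => i; rewrite mem_index_iota => /andP[i1
  iln].
rewrite mulrCA rpredM ?d_dvd ?i1 ?(ltnW iln) //.
(* As i < n the exponent is positive, which the integral expansion of [horner_qleg_expr]
   requires. *)
have -> : (n - i = (n - i).-1.+1)%N by lia.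
rewrite horner_qleg_expr // rpred_sum // => l _.
by rewrite !rpredM ?rpredX ?rpredN ?rpred1.
Qed.

Let h n : R := x^-1 ^+ n / (1 - x^-1 ^+ (n + n).+1).

Let error_bounds n : (0 < n)%N ->
  - (d n / P n * (h n / x ^+ n)) <= approx_den R p n * qlog2 R p - approx_num R p n
   <= - (d n / P n * (h n / (x ^+ n + 1))).
Proof.
move=> n0; have [h1 h2] := qleg_remainder_bounds x_gt1 x_ge2 n0.
have P0 : 0 < P n by apply: lt_le_trans (P_ge1 n).
have dP : 0 < d n / P n by rewrite divr_gt0 // (lt_le_trans _ (d_ge1 n)).
have -> : approx_den R p n * qlog2 R p - approx_num R p n =
  d n / P n * (P n * (P n * (qlog2 R p + \sum_(1 <= k < n) (x ^+ k + 1)^-1)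
                - qint x (diffq_poly (qleg_poly x n) (- x ^+ n)))).
  by rewrite approx_denE approx_numE; field; rewrite gt_eqF.
by apply/andP; split; rewrite -mulrN ler_pM2l.
Qed.

Let err n : R := approx_den R p n * qlog2 R p - approx_num R p n.
Let L : R := ln x.
Let L_gt0 : 0 < L. Proof. exact: ln_gt0. Qed.

Let ln_expr n : ln (x ^+ n) = n%:R * L.
Proof. by rewrite lnXn // mulr_natl. Qed.

(** The norm h is p^(-n) up to a bounded factor, so it affects the rates by linear exponents
    only. *)
Let h_bounds n : (0 < n)%N ->
  x ^- (3 * n) <= h n / (x ^+ n + 1) /\ h n / x ^+ n <= 1.
Proof.
move=> n0; have xn0 : 0 < x ^+ n by rewrite exprn_gt0.
have xn2 : 2 <= x ^+ n by rewrite (le_trans x_ge2) // -[leLHS]expr1 ler_weXn2l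
  // ltW.
have q0 : 0 < x^-1 ^+ n by rewrite exprn_gt0 ?invr_gt0.
set w := x^-1 ^+ (n + n).+1.
have w0 : 0 < w by rewrite exprn_gt0 ?invr_gt0.
have w1 : w <= 1 / 2.
  rewrite /w exprVn div1r lef_pV2 ?posrE ?exprn_gt0 //.
  by rewrite (le_trans x_ge2) // -[leLHS]expr1 ler_weXn2l // ltW.
have qE : x^-1 ^+ n = (x ^+ n)^-1 by rewrite exprVn.
have z0 : 0 < 1 - w by lra.
rewrite /h -/w qE; split.
  have xn10 : 0 < x ^+ n + 1 by rewrite addr_gt0.
  rewrite mulnC exprM -!invfM lef_pV2 ?posrE ?mulr_gt0 ?exprn_gt0 //.
  move: {xn10} (x ^+ n) xn0 xn2 => y y0 y2.
  rewrite !exprS expr0 mulr1 -mulrA ler_pM2l // (le_trans (_ : _ <= 1 * (y +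
    1))) //.
    by rewrite ler_wpM2r //; lra.
  by nra.
rewrite -!invfM invf_le1 ?mulr_gt0 //.
move: (x ^+ n) xn0 xn2 => y y0 y2.
have : 1 <= y * (1 - w) by nra.
by move=> h1; nra.
Qed.

Let err_lt0 n : (0 < n)%N -> err n < 0.
Proof.
move=> n0; have /andP[_ /le_lt_trans] := error_bounds n0; apply.
have [+ _] := h_bounds n0 => hb.
have hb0 : 0 < h n / (x ^+ n + 1).
  by apply: lt_le_trans hb; rewrite invr_gt0 exprn_gt0.
have dP : 0 < d n / P n.
  by rewrite divr_gt0 // ?(lt_le_trans _ (d_ge1 n)) // (lt_le_trans _ (P_ge1 n)).
by rewrite oppr_lt0 mulr_gt0.
Qed.

Let growth_P : quadratic_growth (fun n => ln (P n)) (3 / 2 * L).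
Proof.
move=> eps eps0; exists (4 * L) => n _.
have P0 : 0 < P n by apply: lt_le_trans (P_ge1 n).
have := horner_qlegN_ge x_gt1 n; rewrite -/(P n) -ler_ln ?posrE ?exprn_gt0 //
  ln_expr => lo.
have := horner_qlegN_le x_gt1 x_ge2 n; rewrite -/(P n) -ler_ln ?posrE
  ?exprn_gt0 // ln_expr => up.
have c2 : 'C(n, 2)%:R = (n%:R ^+ 2 - n%:R) / 2 :> R.
  have := triangular_split n 0; rewrite !addn0 binS bin1 => E.
  have {}E := congr1 (fun i => i%:R : R) E; rewrite !natrD natrM in E.
  by rewrite expr2; lra.
move: lo up; rewrite !natrD !natrM {}c2.
have y0 : 0 <= n%:R :> R by [].
have Ly : 0 <= L * n%:R by rewrite mulr_ge0 // ltW.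
have ey : 0 <= eps * n%:R ^+ 2 by rewrite mulr_ge0 ?exprn_ge0 // ltW.
move: (n%:R) (ln (P n)) y0 Ly ey => y u y0 Ly ey lo up.
by rewrite ler_norml; apply/andP; split; lra.
Qed.

(** The base p^2 has logarithm 2 L, so the sum of the k * 2 L is L N^2 to leading order, and the
    inversion divides L by zeta(2). *)
Let growth_d : quadratic_growth (fun n => ln (d n)) (6 / pi ^+ 2 * L).
Proof.
have Lm : ln ((p%:Z ^+ 2)%:~R : R) = 2 * L.
  by rewrite rmorphXn /= lnXn // mulr_natl.
have := @floor_sum_inversion R (log_cyclotomic_prod R (p%:Z ^+ 2)) L (2 * L)
  (pi ^+ 2 / 6).
have L0 : 0 <= 2 * L by rewrite mulr_ge0 // ltW.
move=> /(_ (ltW L_gt0) L0) H eps eps0.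
have [] := H _ _ _ _ eps eps0.
- by rewrite /log_cyclotomic_prod /cyclotomic_prod big_geq // ln1.
- by move=> N; exact: log_cyclotomic_prod_ge0.
- move=> N; rewrite sum_log_cyclotomic_prod //.
  have := sum_ln_expr_sub1 R p2_ge2 N.
  by rewrite Lm [2 * L]mulrC mulfK.
- move=> N N0; apply/andP; split; first exact: sum_inv_sqr_le_pi.
  exact: pi_le_sum_inv_sqr.
move=> C HC; exists C => n _; apply: le_trans (HC n).
by rewrite [L / _]mulrC invf_div.
Qed.

Let growth_den : quadratic_growth (fun n => ln (approx_den R p n)) ((6 / pi ^+
  2 + 3 / 2) * L).
Proof.
rewrite mulrDl; apply: (quadratic_growth_bounded_diff (quadratic_growthD
  growth_d growth_P)).
exists 0 => n n0; rewrite approx_denE lnM ?posrE ?(lt_le_trans ltr01) //.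
by rewrite subrr normr0 mul0r.
Qed.

(** In absolute value the error lies between p^(-3 n) d_n / P_n and d_n / P_n, so its rate is the
    difference of the two rates. *)
Let growth_err : quadratic_growth (fun n => ln `|err n|) ((6 / pi ^+ 2 - 3 / 2)
  * L).
Proof.
rewrite mulrBl; apply: (quadratic_growth_bounded_diff (quadratic_growthB
  growth_d growth_P)).
exists (3 * L) => n n0; rewrite [`|err n|]ltr0_norm ?err_lt0 //.
have d0 : 0 < d n by apply: lt_le_trans (d_ge1 n).
have P0 : 0 < P n by apply: lt_le_trans (P_ge1 n).
have dP : 0 < d n / P n by rewrite divr_gt0.
have [h1 h2] := h_bounds n0; have /andP[e1 e2] := error_bounds n0.
have e0 : 0 < - err n by rewrite oppr_gt0 err_lt0.
have lo : d n / P n * x ^- (3 * n) <= - err n.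
  rewrite lerNr; apply: le_trans e2 _; rewrite lerN2.
  by rewrite ler_pM2l.
have up : - err n <= d n / P n.
  rewrite lerNl; apply: le_trans e1; rewrite lerN2.
  by rewrite ler_piMr // ltW.
rewrite -ln_div ?posrE // ler_norml.
rewrite -ler_ln ?posrE // in up.
rewrite -ler_ln ?posrE ?mulr_gt0 ?invr_gt0 ?exprn_gt0 // lnM ?posrE ?invr_gt0
  ?exprn_gt0 // lnV ?posrE ?exprn_gt0 // ln_expr natrM in lo.
have Ly : 0 <= L * n%:R by rewrite mulr_ge0 // ltW.
move: (ln (- _)) (ln (_ / _)) lo up => u v lo up.
by apply/andP; split; lra.
Qed.

(** Equivalent to 6 / pi^2 < 3 / 2: d_n grows more slowly than P_n, so the error tends to 0. *)
Let pi2_gt4 : 4 < (pi : R) ^+ 2.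
Proof.
have /andP[h1 _] := @pi_rational_bounds R.
have h3 : 3 < pi :> R by lra.
by rewrite expr2; nra.
Qed.

Lemma approximation_theorem :
  [/\ forall n : nat, (1 <= n)%N ->
        [/\ approx_num R p n \is a Num.int,
            approx_den R p n \is a Num.nat,
            1 <= approx_den R p n
          & approx_den R p n * qlog2 R p - approx_num R p n < 0],
      (fun n : nat =>
         `|approx_den R p n * qlog2 R p - approx_num R p n|
           `^ (1 / n%:R ^+ 2)) @ \oo
        --> x `^ (- (3 * (pi ^+ 2 - 4) / (2 * pi ^+ 2))),
      x `^ (- (3 * (pi ^+ 2 - 4) / (2 * pi ^+ 2))) < 1
    & irrational (qlog2 R p) /\
          (irrationality_measure (qlog2 R p)
             <= (2 * pi ^+ 2 / (pi ^+ 2 - 4))%:E)%E].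
Proof.
have pi40 : 0 < (pi : R) ^+ 2 - 4 by rewrite subr_gt0.
have pi20 : 0 < (pi : R) ^+ 2 by apply: lt_trans pi2_gt4.
have xE (y : R) : x `^ y = expR (y * L) by rewrite /powR gt_eqF.
have cE : - (3 * (pi ^+ 2 - 4) / (2 * pi ^+ 2)) * L = (6 / pi ^+ 2 - 3 / 2) * L.
  by congr (_ * _); move: (pi ^+ 2) pi20 => y y0; field; rewrite gt_eqF.
split.
- move=> n n0; split; [exact: approx_num_int|exact: approx_den_nat|exact:
  approx_den_ge1|exact: err_lt0].
- rewrite xE cE.
  rewrite [X in X @ _](_ : _ = (fun n => expR (ln `|err n| / n%:R ^+ 2))).
    apply: continuous_cvg; first exact: continuous_expR.
    exact: quadratic_growth_cvg growth_err.
  (* The functions must agree at n = 0 too, where 1 / 0 = 0 makes both values 1. *)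
  apply/funext => n; rewrite /= -/(err n); case: n => [|n].
    by rewrite expr0n invr0 !mulr0 powRr0 expR0.
  by rewrite /powR normr_eq0 lt_eqF ?err_lt0 // mulrC div1r.
- by rewrite xE -[ltRHS]expR0 ltr_expR mulNr oppr_lt0 !mulr_gt0 // invr_gt0
  mulr_gt0.
pose A : R := (3 / 2 - 6 / pi ^+ 2) * L; pose B : R := (6 / pi ^+ 2 + 3 / 2) * L.
have A0 : 0 < A.
  rewrite mulr_gt0 // subr_gt0 ltr_pdivrMr //; have := pi2_gt4; lra.
have B0 : 0 < B by rewrite mulr_gt0 // addr_gt0 // divr_gt0.
(* The criterion speaks of integer sequences. The floors are exact, for [b] at every n and for [a]
   at every n > 0. *)
pose a n := Num.floor (approx_num R p n); pose b n := Num.floor (approx_den R p n).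
have bE n : (b n)%:~R = approx_den R p n by rewrite floorK.
have aE n : (0 < n)%N -> (a n)%:~R = approx_num R p n by move=> n0;
  rewrite floorK // approx_num_int.
have b0 n : (0 < n)%N -> 0 < b n.
  by move=> _; rewrite -(ltr0z R) bE (lt_le_trans ltr01).
have eE n : (0 < n)%N -> (b n)%:~R * qlog2 R p - (a n)%:~R = err n.
  by move=> n0; rewrite bE aE.
have e0 n : (0 < n)%N -> (b n)%:~R * qlog2 R p - (a n)%:~R != 0.
  by move=> n0; rewrite eE // lt_eqF // err_lt0.
have gb : quadratic_growth (fun n => ln ((b n)%:~R : R)) B.
  apply: (quadratic_growth_bounded_diff growth_den); exists 0 => n _.
  by rewrite bE subrr normr0 mul0r.
have ge : quadratic_growth (fun n => ln `|(b n)%:~R * qlog2 R p - (a n)%:~R|) (- A).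
  rewrite -mulNr opprB; apply: (quadratic_growth_bounded_diff growth_err).
  by exists 0 => n n0; rewrite eE // subrr normr0 mul0r.
split; first exact: (irrational_criterion A0 e0 ge).
have := irrationality_measure_criterion A0 B0 b0 e0 gb ge.
rewrite (_ : 1 + B / A = 2 * pi ^+ 2 / (pi ^+ 2 - 4)) //.
have pi2' := gt_eqF pi20; have pi4' := gt_eqF pi40; have L' := gt_eqF L_gt0.
have -> : A = 3 * (pi ^+ 2 - 4) / (2 * pi ^+ 2) * L.
  by rewrite /A; congr (_ * _); move: (pi ^+ 2) pi2' => y y0; field; rewrite y0.
have -> : B = 3 * (pi ^+ 2 + 4) / (2 * pi ^+ 2) * L.
  by rewrite /B; congr (_ * _); move: (pi ^+ 2) pi2' => y y0; field; rewrite y0.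
move: (pi ^+ 2) pi2' pi4' => y y0 y4.
by field; rewrite y0 y4 L'.
Qed.

End Approximations.

Theorem theorem2 (R : realType) (p : nat) (hp : (1 < p)%N) :
  [/\ forall n : nat, (1 <= n)%N ->
        [/\ approx_num R p n \is a Num.int,
            approx_den R p n \is a Num.nat,
            1 <= approx_den R p n
          & approx_den R p n * qlog2 R p - approx_num R p n < 0],
      (fun n : nat =>
         `|approx_den R p n * qlog2 R p - approx_num R p n|
           `^ (1 / n%:R ^+ 2)) @ \oo
        --> (p%:R : R) `^ (- (3 * (pi ^+ 2 - 4) / (2 * pi ^+ 2))),
      (p%:R : R) `^ (- (3 * (pi ^+ 2 - 4) / (2 * pi ^+ 2))) < 1
    & [/\ irrational (qlog2 R p),
          (irrationality_measure (qlog2 R p)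
             <= (2 * pi ^+ 2 / (pi ^+ 2 - 4))%:E)%E
        & 336 / 10 ^+ 2 + 295 / 10 ^+ 5 <= 2 * (pi : R) ^+ 2 / (pi ^+ 2 - 4)
            < 336 / 10 ^+ 2 + 296 / 10 ^+ 5]].
Proof.
have [h1 h2 h3 [h4 h5]] := approximation_theorem R hp.
by split => //; split => //; exact: measure_bound_decimals.
Qed.
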